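(* Let $X$ be a rack and $k$ a commutative ring with unit. The map $h$ induces a homotopy between $\smile$ and $\smile^{op}$ in $C^\bullet(X,k)$: the degree $-1$ map $H:C^\bullet(X,k)\otimes C^\bullet(X,k)\to C^\bullet(X,k)$ defined, under the identification $C^n(X,k)\cong \mathrm{Hom}_A(B_n,k)$, by $H(f\otimes g)=-\,i(f\otimes g)\circ h$, satisfies for all homogeneous $f,g$ $$f\smile g-(-1)^{|f||g|}g\smile f=\partial^*\big(H(f\otimes g)\big)+H\big((-1)^{|g|}\partial^*f\otimes g+f\otimes\partial^*g\big).$$ In particular, the rack cohomology $H^\bullet(X,k)$, with the product induced by $\smile$, is graded commutative.
   Context: A rack is a nonempty set $X$ with a binary operation $(x,y)\mapsto x\triangleleft y=x^y$ such that $-\triangleleft y:X\to X$ is a bijection for every $y$, and $(x\triangleleft y)\triangleleft z=(x\triangleleft z)\triangleleft(y\triangleleft z)$ for all $x,y,z$. Rack complex: $C_n(X,k)=k[X^n]$ is the free $k$-module on $X^n$, with $$\partial(x_1,\dots,x_n)=\sum_{i=1}^n(-1)^i(x_1,\dots,\widehat{x_i},\dots,x_n)-\sum_{i=1}^n(-1)^i(x_1^{x_i},\dots,x_{i-1}^{x_i},\widehat{x_i},x_{i+1},\dots,x_n),$$ where $\widehat{x_i}$ means omission. $C^n(X,k)=\mathrm{Hom}_k(C_n(X,k),k)$, $\partial^*f=f\circ\partial$, and $H^\bullet(X,k)$ is the cohomology of $(C^\bullet(X,k),\partial^* )$. Let $A$ be the $k$-algebra generated by $X$ with relations $yx^y=xy$.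 Let $B$ be the $k$-algebra generated by symbols $x,e_x$ ($x\in X$) with relations $yx^y=xy$ and $y\,e_{x^y}=e_x\,y$ for all $x,y\in X$, graded by $|x|=0$, $|e_x|=1$. $B\otimes B$ (over $k$) has the Koszul-signed product $(a\otimes b)(a'\otimes b')=(-1)^{|b||a'|}aa'\otimes bb'$, and $\Delta:B\to B\otimes B$ is the algebra morphism with $\Delta(x)=x\otimes x$, $\Delta(e_x)=e_x\otimes x+1\otimes e_x$. The signed flip is $\tau(a\otimes b)=(-1)^{|a||b|}b\otimes a$. $B\otimes^D B$ is $B\otimes B$ with the diagonal left $A$-action $x\cdot(b\otimes b')=xb\otimes xb'$ for $x\in X$. $B$ is a left $A$-module by left multiplication, free with basis the monomials $e_{x_1}\cdots e_{x_n}$; $k$ is a left $A$-module with every $x\in X$ acting as the identity; $\mathrm{Hom}_A$ denotes left $A$-linear maps. The identification $C^n(X,k)\cong\mathrm{Hom}_A(B_n,k)$ is $f(e_{x_1}\cdots e_{x_n})=f(x_1,\dots,x_n)$; such $f$ has degree $n$ and is extended by zero to the other degrees of $B$. For homogeneous elements $i(f\otimes g)(b\otimes b')=(-1)^{|g||b|}f(b)g(b')$. The cup product is $f\smile g=i(f\otimes g)\circ\Delta$, and $f\smile^{op}g=(-1)^{|f||g|}g\smile f$. $h:B\to B\otimes^D B$ is the degree one left $A$-module morphism with $h(1)=0$, $h(e_x)=e_x\otimes e_x$ and $$h(e_{x_1}\cdots e_{x_n})=\sum_{i=1}^n(-1)^{i-1}(\tau\circ\Delta)(e_{x_1})\cdots(\tau\circ\Delta)(e_{x_{i-1}})\,h(e_{x_i})\,\Delta(e_{x_{i+1}})\cdots\Delta(e_{x_n}).$$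 *)

(* Defs.v *)
From HB Require Import structures.
From mathcomp Require Import all_boot ssralg ring_quotient.
From mathcomp Require Import boolp functions finmap.
From mathcomp Require Import monalg zify.

Set Implicit Arguments.
Unset Strict Implicit.
Unset Printing Implicit Defensive.

Import GRing.Theory.
Local Open Scope ring_scope.
Local Open Scope quotient_scope.

Reserved Notation "x ◁ y" (at level 40, left associativity).
Reserved Notation "a ⊗ b" (at level 40, left associativity).

HB.mixin Record isRack X of Choice X := {
  rop : X -> X -> X;
  rack_nonempty : exists x : X, True;
  rop_bij : forall y, bijective (fun x => rop x y);
  ropD : forall x y z, rop (rop x y) z = rop (rop x z) (rop y z)
}.
#[short(type="rackType")]
HB.structure Definition Rack := {X of isRack X & Choice X}.
Notation "x ◁ y" := (rop x y).

Definition restr (S R : pzRingType) (f : {rmorphism S -> R}) (V : lmodType R) :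
  Type := V.

Section Restriction.
Context (S R : pzRingType) (f : {rmorphism S -> R}) (V : lmodType R).
HB.instance Definition _ := GRing.Zmodule.on (restr f V).

Definition restr_scale (a : S) (v : restr f V) : restr f V := f a *: (v : V).

Fact restr_scaleA a b v :
  restr_scale a (restr_scale b v) = restr_scale (a * b) v.
Proof. by rewrite /restr_scale rmorphM /= scalerA. Qed.
Fact restr_scale1 : left_id 1 restr_scale.
Proof. by move=> v; rewrite /restr_scale rmorph1 scale1r. Qed.
Fact restr_scaleDr : right_distributive restr_scale +%R.
Proof. by move=> a u v; rewrite /restr_scale scalerDr. Qed.
Fact restr_scaleDl v : {morph restr_scale^~ v : a b / a + b}.
Proof. by move=> a b; rewrite /restr_scale rmorphD scalerDl. Qed.
HB.instance Definition _ := GRing.Zmodule_isLmodule.Build S (restr f V)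
  restr_scaleA restr_scale1 restr_scaleDr restr_scaleDl.

Lemma restr_scaleE (a : S) (v : restr f V) : a *: v = (f a *: (v : V) : V).
Proof. by []. Qed.
End Restriction.

Definition freemod (k : comPzRingType) (T : choiceType) : Type := {malg k[T]}.

HB.lock Definition bas (k : comPzRingType) (T : choiceType) (t : T) :
  freemod k T := mkmalgU t 1.

Section FreeModule.
Context (k : comPzRingType) (T : choiceType).
HB.instance Definition _ := GRing.Zmodule.on (freemod k T).

Local Notation bas := (@bas k T).

Fact mcoeff_bas s t : (bas s)@_t = (s == t)%:R.
Proof. by rewrite bas.unlock mcoeffU. Qed.

Definition freemod_scale (c : k) (a : freemod k T) : freemod k T :=
  [malg t in msupp a => c * a@_t].

Fact freemod_scaleE c a t : (freemod_scale c a)@_t = c * a@_t.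
Proof. by rewrite mcoeffE; case: msuppP => //; rewrite mulr0. Qed.
Fact freemod_scaleA c d a :
  freemod_scale c (freemod_scale d a) = freemod_scale (c * d) a.
Proof. by apply/malgP=> t; rewrite !freemod_scaleE mulrA. Qed.
Fact freemod_scale1 : left_id 1 freemod_scale.
Proof. by move=> a; apply/malgP=> t; rewrite !freemod_scaleE mul1r. Qed.
Fact freemod_scaleDr : right_distributive freemod_scale +%R.
Proof.
move=> c a b; apply/malgP=> t.
by rewrite freemod_scaleE !mcoeffD !freemod_scaleE mulrDr.
Qed.
Fact freemod_scaleDl a : {morph freemod_scale^~ a : c d / c + d}.
Proof.
move=> c d; apply/malgP=> t.
by rewrite mcoeffD !freemod_scaleE mulrDl.
Qed.
HB.instance Definition _ := GRing.Zmodule_isLmodule.Build k (freemod k T)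
  freemod_scaleA freemod_scale1 freemod_scaleDr freemod_scaleDl.

Lemma mcoeff_scale (c : k) (a : freemod k T) t : (c *: a)@_t = c * a@_t.
Proof. exact: freemod_scaleE. Qed.

Lemma freemodE (a : freemod k T) : a = \sum_(t <- msupp a) a@_t *: bas t.
Proof.
rewrite [LHS]monalgE; apply: eq_bigr => t _; apply/malgP=> s.
by rewrite mcoeff_scale mcoeff_bas mcoeffU mulr_natr.
Qed.

Lemma freemod_ind (P : freemod k T -> Prop) :
  P 0 -> (forall c t a, P a -> P (c *: bas t + a)) -> forall a, P a.
Proof.
move=> P0 PD a; rewrite (freemodE a).
by elim: (enum_fset (msupp a)) => [|t s IHs]; rewrite ?big_nil ?big_cons //; apply: PD.
Qed.

End FreeModule.

HB.lock Definition lext (k : comPzRingType) (T : choiceType) (V : lmodType k)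
  (phi : T -> V) (a : freemod k T) : V := \sum_(t <- msupp a) a@_t *: phi t.

Section LinearExtension.
Context (k : comPzRingType) (T : choiceType).
Section Lext.
Context (V : lmodType k) (phi : T -> V).

Lemma lextEw (d : {fset T}) (a : freemod k T) : (msupp a `<=` d)%fset ->
  lext phi a = \sum_(t <- d) a@_t *: phi t.
Proof.
move=> le; rewrite lext.unlock [LHS](big_fset_incl _ le) //= => t _ /mcoeff_outdom ->.
by rewrite scale0r.
Qed.

Fact lext_is_linear : linear (lext phi).
Proof.
move=> c a b; set d := (msupp a `|` msupp b `|` msupp (c *: a + b))%fset.
rewrite !(@lextEw d) ?fsubsetUr //; first last.
- by rewrite /d -fsetUA fsubsetUl.
- by rewrite /d fsetUAC fsubsetUr.
rewrite scaler_sumr -big_split /=; apply: eq_bigr => t _.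
by rewrite mcoeffD mcoeff_scale scalerDl scalerA.
Qed.
HB.instance Definition _ :=
  GRing.isLinear.Build k (freemod k T) V _ (lext phi) lext_is_linear.

Lemma lextE t : lext phi (bas k t) = phi t.
Proof.
rewrite (lextEw (d := [fset t]%fset)); last by rewrite bas.unlock msuppU_le.
by rewrite big_seq_fset1 mcoeff_bas eqxx scale1r.
Qed.
End Lext.

Lemma freemod_ext (V : lmodType k) (u v : {linear freemod k T -> V}) :
  (forall t, u (bas k t) = v (bas k t)) -> u =1 v.
Proof.
move=> uv; elim/freemod_ind => [|c t a IHa]; first by rewrite !linear0.
by rewrite !linearP IHa uv.
Qed.
End LinearExtension.

HB.lock Definition bprod (k : comPzRingType) (T : choiceType)
  (mu : T -> T -> freemod k T) (a b : freemod k T) : freemod k T :=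
  lext (fun s => lext (mu s) b) a.

Section BasisProduct.
Context (k : comPzRingType) (T : choiceType) (mu : T -> T -> freemod k T).
Local Notation bprod := (bprod mu).

Lemma bprodPl c a a' b : bprod (c *: a + a') b = c *: bprod a b + bprod a' b.
Proof. by rewrite bprod.unlock linearP. Qed.
Lemma bprod0l b : bprod 0 b = 0.
Proof. by rewrite bprod.unlock linear0. Qed.
Lemma bprod_bas s b : bprod (bas k s) b = lext (mu s) b.
Proof. by rewrite bprod.unlock lextE. Qed.
Lemma bprodPr c a b b' : bprod a (c *: b + b') = c *: bprod a b + bprod a b'.
Proof.
elim/freemod_ind: a => [|d t a IHa]; first by rewrite !bprod0l scaler0 addr0.
rewrite !(bprodPl d) IHa !bprod_bas linearP !scalerDr !scalerA mulrC.
by rewrite addrACA.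
Qed.
Lemma bprod0r a : bprod a 0 = 0.
Proof. by have := bprodPr (-1) a 0 0; rewrite scaler0 addr0 scaleN1r addNr. Qed.
Lemma bprodDl : left_distributive bprod +%R.
Proof. by move=> a b c; have := bprodPl 1 a b c; rewrite !scale1r. Qed.
Lemma bprodDr : right_distributive bprod +%R.
Proof. by move=> a b c; have := bprodPr 1 a b c; rewrite !scale1r. Qed.
Lemma bprodZl c a b : c *: bprod a b = bprod (c *: a) b.
Proof. by have := bprodPl c a 0 b; rewrite !addr0 bprod0l addr0. Qed.
Lemma bprodZr c a b : c *: bprod a b = bprod a (c *: b).
Proof. by have := bprodPr c a b 0; rewrite !addr0 bprod0r addr0. Qed.
Lemma bprodE s t : bprod (bas k s) (bas k t) = mu s t.
Proof. by rewrite bprod_bas lextE. Qed.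

Hypothesis muA : forall s t u,
  bprod (bas k s) (mu t u) = bprod (mu s t) (bas k u).
Lemma bprodA : associative bprod.
Proof.
move=> a b c; elim/freemod_ind: a => [|d s a IHa]; first by rewrite !bprod0l.
rewrite !(bprodPl d) IHa; congr (_ *: _ + _) => {a IHa}.
elim/freemod_ind: b => [|e t b IHb]; first by rewrite !(bprod0l, bprod0r).
rewrite !(bprodPl e, bprodPr e) IHb; congr (_ *: _ + _) => {b IHb}.
elim/freemod_ind: c => [|f u c IHc]; first by rewrite !bprod0r.
by rewrite !(bprodPr f) IHc !bprodE muA.
Qed.

Context (t1 : T).
Hypotheses (mu1l : forall t, mu t1 t = bas k t) (mu1r : forall t, mu t t1 = bas k t).
Lemma bprod1l : left_id (bas k t1) bprod.
Proof.
elim/freemod_ind => [|d s a IHa]; first by rewrite !bprod0r.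
by rewrite bprodPr IHa bprodE mu1l.
Qed.
Lemma bprod1r : right_id (bas k t1) bprod.
Proof.
elim/freemod_ind => [|d s a IHa]; first by rewrite !bprod0l.
by rewrite bprodPl IHa bprodE mu1r.
Qed.
End BasisProduct.

Section PresentedMonoid.
Context (G : choiceType) (R : seq G -> seq G -> Prop).

Inductive wcong : seq G -> seq G -> Prop :=
| WcongRel u v s t : R s t -> wcong (u ++ s ++ v) (u ++ t ++ v)
| WcongRefl w : wcong w w
| WcongSym w w' : wcong w w' -> wcong w' w
| WcongTrans w w' w'' : wcong w w' -> wcong w' w'' -> wcong w w''.

Definition wcongb u v := `[< wcong u v >].

Fact wcongb_equiv : equiv_class_of wcongb.
Proof.
split=> [w|w w'|w' w w'']; first exact/asboolP/WcongRefl.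
  by apply: asbool_equiv_eq; split=> /WcongSym.
by move=> /asboolP ww' /asboolP w'w''; apply/asboolP; apply: WcongTrans w'w''.
Qed.
Canonical wcong_equiv_rel := EquivRelPack wcongb_equiv.
Canonical wcong_encModRel := defaultEncModRel wcongb.

Definition presmon := {eq_quot wcongb}.
HB.instance Definition _ := Choice.on presmon.
HB.instance Definition _ := EqQuotient.on presmon.

Lemma presmonP u v : \pi_presmon u = \pi_presmon v <-> wcong u v.
Proof. by split=> [/eqmodP/asboolP|uv]; [|apply/eqmodP/asboolP]. Qed.

Lemma wcong_cat u u' v v' : wcong u u' -> wcong v v' -> wcong (u ++ v) (u' ++ v').
Proof.
move=> uu' vv'; apply: (@WcongTrans _ (u' ++ v)).
  elim: uu' v {v' vv'} => {u u'} [u w s t st|w|w w' _ IH|w w' w'' _ IH _ IH'] v.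
  - by rewrite -!catA; constructor.
  - exact: WcongRefl.
  - exact/WcongSym/IH.
  - exact: WcongTrans (IH v) (IH' v).
elim: vv' => {v v'} [v w s t st|w|w w' _ IH|w w' w'' _ IH _ IH'].
- by rewrite (catA u') (catA u'); constructor.
- exact: WcongRefl.
- exact/WcongSym/IH.
- exact: WcongTrans IH IH'.
Qed.

Lemma presmon_surj (a : presmon) : exists u, a = \pi_presmon u.
Proof. by exists (repr a); rewrite reprK. Qed.

Definition presmon_one : presmon := \pi_presmon [::].
Definition presmon_mul (a b : presmon) : presmon := \pi_presmon (repr a ++ repr b).

Fact presmon_mulE u v : presmon_mul (\pi_presmon u) (\pi_presmon v) = \pi_presmon (u ++ v).
Proof. by apply/presmonP/wcong_cat; apply/presmonP; rewrite reprK. Qed.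
Fact presmon_mulA : associative presmon_mul.
Proof.
move=> a b c; have [[u ->] [v ->] [w ->]] := And3 (presmon_surj a)
  (presmon_surj b) (presmon_surj c).
by rewrite [in RHS]presmon_mulE [in LHS](presmon_mulE v) !presmon_mulE catA.
Qed.
Fact presmon_mul1m : left_id presmon_one presmon_mul.
Proof. by move=> a; have [u ->] := presmon_surj a; rewrite presmon_mulE. Qed.
Fact presmon_mulm1 : right_id presmon_one presmon_mul.
Proof. by move=> a; have [u ->] := presmon_surj a; rewrite presmon_mulE cats0. Qed.
HB.instance Definition _ :=
  isMonoid.Build presmon presmon_mulA presmon_mul1m presmon_mulm1.

Lemma pi_cat u v : \pi_presmon (u ++ v) = (\pi_presmon u * \pi_presmon v)%g.
Proof. by rewrite -presmon_mulE. Qed.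
End PresentedMonoid.

Definition monoid_alg (k : comPzRingType) (M : monoidType) : Type := freemod k M.

Section MonoidAlgebra.
Context (k : comPzRingType) (M : monoidType).
Local Notation mu := (fun a b : M => bas k (a * b)%g).

HB.instance Definition _ := GRing.Lmodule.on (monoid_alg k M).

Fact monoid_alg_muA (s t u : M) :
  bprod mu (bas k s) (mu t u) = bprod mu (mu s t) (bas k u).
Proof. by rewrite !bprodE /= mulgA. Qed.
Fact monoid_alg_mu1l (t : M) : mu 1%g t = bas k t. Proof. by rewrite /= mul1g. Qed.
Fact monoid_alg_mu1r (t : M) : mu t 1%g = bas k t. Proof. by rewrite /= mulg1. Qed.

HB.instance Definition _ := GRing.Zmodule_isPzRing.Build (monoid_alg k M)
  (bprodA monoid_alg_muA) (bprod1l monoid_alg_mu1l) (bprod1r monoid_alg_mu1r)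
  (bprodDl mu) (bprodDr mu).

Lemma monoid_algZl c (a b : monoid_alg k M) : c *: (a * b) = (c *: a) * b.
Proof. exact: (bprodZl mu). Qed.
Lemma monoid_algZr c (a b : monoid_alg k M) : c *: (a * b) = a * (c *: b).
Proof. exact: (bprodZr mu). Qed.

Definition scalar_map (c : k) : monoid_alg k M := c *: (1 : monoid_alg k M).
Fact scalar_map_is_zmod_morphism : zmod_morphism scalar_map.
Proof. by move=> c d; rewrite /scalar_map scalerBl. Qed.
HB.instance Definition _ := GRing.isZmodMorphism.Build k (monoid_alg k M)
  scalar_map scalar_map_is_zmod_morphism.
Fact scalar_map_is_monoid_morphism : monoid_morphism scalar_map.
Proof.
split=> [|c d]; first exact: scale1r.
by rewrite /scalar_map -monoid_algZl mul1r scalerA.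
Qed.
HB.instance Definition _ := GRing.isMonoidMorphism.Build k (monoid_alg k M)
  scalar_map scalar_map_is_monoid_morphism.
Lemma scalar_mapM c a : scalar_map c * a = c *: a.
Proof. by rewrite /scalar_map -monoid_algZl mul1r. Qed.
Lemma scalar_mapC c a : scalar_map c * a = a * scalar_map c.
Proof. by rewrite scalar_mapM /scalar_map -monoid_algZr mulr1. Qed.
Lemma monoid_alg1 : 1 = bas k 1%g :> monoid_alg k M. Proof. by []. Qed.
Lemma monoid_algM (s t : M) :
  (bas k s : monoid_alg k M) * (bas k t : monoid_alg k M) = bas k (s * t)%g.
Proof. exact: bprodE. Qed.
End MonoidAlgebra.

(* The k-algebra generated by G with relations s = t for R s t. The relations *)
(* being monomial, it is the monoid algebra of the presented monoid; its      *)
(* universal property is [pres_mapE] and [pres_map_uniq].                     *)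
Definition presalg (k : comPzRingType) (G : choiceType)
  (R : seq G -> seq G -> Prop) : Type := monoid_alg k (presmon R).

Section PresentedAlgebra.
Context (k : comPzRingType) (G : choiceType) (R : seq G -> seq G -> Prop).
HB.instance Definition _ := GRing.Lmodule.on (presalg k R).
HB.instance Definition _ := GRing.PzRing.on (presalg k R).

Definition gen (g : G) : presalg k R := bas k (\pi_(presmon R) [:: g]).

Lemma prod_gen (w : seq G) : \prod_(g <- w) gen g = bas k (\pi_(presmon R) w).
Proof.
elim: w => [|g w IHw]; first by rewrite big_nil.
by rewrite big_cons IHw -cat1s pi_cat -monoid_algM.
Qed.

Lemma gen_rel s t : R s t -> \prod_(g <- s) gen g = \prod_(g <- t) gen g.
Proof.
move=> st; rewrite !prod_gen; congr (bas k _); apply/presmonP.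
by have := WcongRel [::] [::] st; rewrite !cats0.
Qed.

(* The target is a k-algebra S, given as a ring with a central morphism [eta] *)
(* from k: the library's [algType k] would exclude the trivial ring.          *)
Context (S : pzRingType) (eta : {rmorphism k -> S}) (y : G -> S).
Hypothesis etaC : forall c s, eta c * s = s * eta c.
Hypothesis yR :
  forall s t, R s t -> \prod_(g <- s) y g = \prod_(g <- t) y g.

Fact prod_wcong u v : wcong R u v -> \prod_(g <- u) y g = \prod_(g <- v) y g.
Proof.
elim=> {u v} [u v s t /yR st|//|//|u v w _ -> _ -> //].
by rewrite !big_cat /= st.
Qed.

Definition pres_map (_ : forall c s, eta c * s = s * eta c)
    (_ : forall s t, R s t -> \prod_(g <- s) y g = \prod_(g <- t) y g) :
    presalg k R -> S :=
  lext (V := restr eta S^o) (fun m : presmon R => \prod_(g <- repr m) y g).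
Local Notation pm := (pres_map etaC yR).

Lemma pres_mapP c a b : pm (c *: a + b) = eta c * pm a + pm b.
Proof. exact: (@lext_is_linear _ _ (restr eta S^o)). Qed.

Fact pres_map_is_zmod_morphism : zmod_morphism pm.
Proof.
move=> a b; rewrite addrC -scaleN1r pres_mapP rmorphN1 mulN1r.
by rewrite addrC.
Qed.
HB.instance Definition _ := GRing.isZmodMorphism.Build (presalg k R) S pm
  pres_map_is_zmod_morphism.

Lemma pres_mapZ c a : pm (c *: a) = eta c * pm a.
Proof. by rewrite -[c *: a]addr0 pres_mapP raddf0 addr0. Qed.

Lemma pres_map_pi w : pm (bas k (\pi_(presmon R) w)) = \prod_(g <- w) y g.
Proof.
rewrite /pres_map lextE; apply: prod_wcong; apply/presmonP.
by rewrite reprK.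
Qed.

Fact pres_map_is_monoid_morphism : monoid_morphism pm.
Proof.
split; first by rewrite [1](_ : _ = bas k (\pi_(presmon R) [::])) // pres_map_pi big_nil.
move=> a b; elim/freemod_ind: a => [|c m a IHa].
  by rewrite mul0r raddf0 mul0r.
rewrite mulrDl -monoid_algZl !pres_mapP IHa mulrDl -mulrA.
congr (_ * _ + _); elim/freemod_ind: b {IHa} => [|d n b IHb].
  by rewrite mulr0 raddf0 mulr0.
rewrite mulrDr -monoid_algZr !pres_mapP IHb mulrDr mulrA -etaC -mulrA.
congr (_ * _ + _); rewrite monoid_algM.
have [[u ->] [v ->]] := conj (presmon_surj m) (presmon_surj n).
by rewrite -pi_cat !pres_map_pi big_cat.
Qed.
HB.instance Definition _ := GRing.isMonoidMorphism.Build (presalg k R) S pm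
  pres_map_is_monoid_morphism.

Lemma pres_mapE g : pm (gen g) = y g.
Proof. by rewrite pres_map_pi big_seq1. Qed.

Lemma pres_map_uniq (f : {rmorphism presalg k R -> S}) :
  (forall c a, f (c *: a) = eta c * f a) -> (forall g, f (gen g) = y g) ->
  f =1 pm.
Proof.
move=> fZ fy a; elim/freemod_ind: a => [|c m a IHa]; first by rewrite !raddf0.
rewrite raddfD /= fZ pres_mapP IHa; congr (_ * _ + _).
have [w ->] := presmon_surj m; rewrite pres_map_pi -prod_gen rmorph_prod.
by apply: eq_bigr => g _.
Qed.
End PresentedAlgebra.

Section RackMonoids.
Context (X : rackType).

Inductive Arel : seq X -> seq X -> Prop :=
| ArelI x y : Arel [:: y; x ◁ y] [:: x; y].

(* The generator x is [inl x], the generator e_x is [inr x]. *)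
Inductive Brel : seq (X + X) -> seq (X + X) -> Prop :=
| BrelX x y : Brel [:: inl y; inl (x ◁ y)] [:: inl x; inl y]
| BrelE x y : Brel [:: inl y; inr (x ◁ y)] [:: inr x; inl y].

Definition Amon := presmon Arel.
Definition Bmon := presmon Brel.
HB.instance Definition _ := Monoid.on Amon.
HB.instance Definition _ := Monoid.on Bmon.
HB.instance Definition _ := EqQuotient.on Amon.
HB.instance Definition _ := EqQuotient.on Bmon.

Definition racts (x : X) (u : seq X) : X := foldl rop x u.

(* Since e_x y = y e_{x^y}, the word w equals u e_{x_1} ... e_{x_n} in B,     *)
(* where (u, [:: x_1; ...; x_n]) = nfw w.                                     *)
Fixpoint nfw (w : seq (X + X)) : seq X * seq X :=
  match w with
  | [::] => ([::], [::])
  | inl x :: w' => (x :: (nfw w').1, (nfw w').2)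
  | inr x :: w' => ((nfw w').1, racts x (nfw w').1 :: (nfw w').2)
  end.

Lemma nfw_cat v w : nfw (v ++ w) =
  ((nfw v).1 ++ (nfw w).1,
   [seq racts x (nfw w).1 | x <- (nfw v).2] ++ (nfw w).2).
Proof.
elim: v => [|[x|x] v IHv] /=; first by case: (nfw w).
  by rewrite IHv.
by rewrite IHv /= /racts foldl_cat.
Qed.

Lemma racts_wcong u v : wcong Arel u v -> racts^~ u =1 racts^~ v.
Proof.
elim=> {u v} [u v _ _ [x y]|//|u v _ IH|u v w _ IH _ IH'] z.
- by rewrite /racts !foldl_cat /= -ropD.
- by rewrite IH.
- by rewrite IH IH'.
Qed.

Lemma nfw_wcong u v : wcong Brel u v ->
  wcong Arel (nfw u).1 (nfw v).1 /\ (nfw u).2 = (nfw v).2.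
Proof.
elim=> {u v} [u v s t st|w|w w' _ [IH ->]|w w' w'' _ [IH ->] _ [IH' ->]].
- have [st1 st2] : wcong Arel (nfw s).1 (nfw t).1 /\ (nfw s).2 = (nfw t).2.
    case: st => x y /=; last by split=> //; apply: WcongRefl.
    by split=> //; exact: (WcongRel [::] [::] (ArelI x y)).
  have wsv : wcong Arel ((nfw s).1 ++ (nfw v).1) ((nfw t).1 ++ (nfw v).1).
    by apply: wcong_cat => //; apply: WcongRefl.
  rewrite !nfw_cat /= st2; split.
    by apply: wcong_cat => //; apply: WcongRefl.
  by congr (_ ++ _); apply/eq_map/racts_wcong.
- by split=> //; apply: WcongRefl.
- by split=> //; apply: WcongSym.
- by split=> //; apply: WcongTrans IH'.
Qed.

Lemma nfwP w : wcong Brel w (map inl (nfw w).1 ++ map inr (nfw w).2).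
Proof.
elim: w => [|[x|x] w IHw] /=; first exact: WcongRefl.
  exact: (wcong_cat (WcongRefl _ [:: inl x]) IHw).
apply: WcongTrans (wcong_cat (WcongRefl _ [:: inr x]) IHw) _ => /=.
elim: {w IHw} (nfw w).1 (map inr _) x => [|y u IHu] v x /=; first exact: WcongRefl.
apply: (@WcongTrans _ _ _ [:: inl y, inr (x ◁ y) & map inl u ++ v]).
  exact/WcongSym/(WcongRel [::] (map inl u ++ v) (BrelE x y)).
exact: (wcong_cat (WcongRefl _ [:: inl y]) (IHu v (x ◁ y))).
Qed.

Definition apart (m : Bmon) : Amon := \pi_Amon (nfw (repr m)).1.
Definition epart (m : Bmon) : seq X := (nfw (repr m)).2.

Fact nfw_repr w :
  wcong Arel (nfw (repr (\pi_Bmon w))).1 (nfw w).1 /\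
  (nfw (repr (\pi_Bmon w))).2 = (nfw w).2.
Proof. by apply/nfw_wcong/presmonP; rewrite reprK. Qed.
Lemma apart_pi w : apart (\pi_Bmon w) = \pi_Amon (nfw w).1.
Proof. by apply/presmonP; have [] := nfw_repr w. Qed.
Lemma epart_pi w : epart (\pi_Bmon w) = (nfw w).2.
Proof. by have [] := nfw_repr w. Qed.

(* The number of factors e_x of the monomial m. *)
Definition degm (m : Bmon) : nat := size (epart m).

Lemma size_nfw_cat v w :
  size (nfw (v ++ w)).2 = (size (nfw v).2 + size (nfw w).2)%N.
Proof. by rewrite nfw_cat size_cat size_map. Qed.

Lemma degm1 : degm 1%g = 0. Proof. by rewrite /degm epart_pi. Qed.
Lemma degmM m n : degm (m * n)%g = (degm m + degm n)%N.
Proof.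
have [[u ->] [v ->]] := conj (presmon_surj m) (presmon_surj n).
by rewrite /degm -pi_cat !epart_pi size_nfw_cat.
Qed.
End RackMonoids.

Section RackAlgebras.
Context (k : comPzRingType) (X : rackType).

Definition Aalg : Type := presalg k (@Arel X).
Definition Balg : Type := presalg k (@Brel X).
HB.instance Definition _ := GRing.Lmodule.on Aalg.
HB.instance Definition _ := GRing.PzRing.on Aalg.
HB.instance Definition _ := GRing.Lmodule.on Balg.
HB.instance Definition _ := GRing.PzRing.on Balg.

Definition genA (x : X) : Aalg := gen k (@Arel X) x.
Definition genX (x : X) : Balg := gen k (@Brel X) (inl x).
Definition genE (x : X) : Balg := gen k (@Brel X) (inr x).

Lemma genA_rel x y : genA y * genA (x ◁ y) = genA x * genA y.
Proof. by have := gen_rel k (ArelI x y); rewrite !big_cons !big_nil !mulr1. Qed.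
Lemma genX_rel x y : genX y * genX (x ◁ y) = genX x * genX y.
Proof. by have := gen_rel k (BrelX x y); rewrite !big_cons !big_nil !mulr1. Qed.
Lemma genE_rel x y : genX y * genE (x ◁ y) = genE x * genX y.
Proof. by have := gen_rel k (BrelE x y); rewrite !big_cons !big_nil !mulr1. Qed.

(* B is free over k on the monoid Bmon, so that B ⊗ B is free on the pairs;   *)
(* the universal property of the tensor product is [tens_liftE].              *)
Definition BB : Type := freemod k (Bmon X * Bmon X)%type.
HB.instance Definition _ := GRing.Lmodule.on BB.

Definition tens (a b : Balg) : BB :=
  lext (fun m => lext (fun n => bas k (m, n) : BB) b) a.
Local Notation "a ⊗ b" := (tens a b).

(* (a ⊗ b)(a' ⊗ b') = (-1)^{|b||a'|} aa' ⊗ bb' on monomials. *)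
Definition koszul (p q : Bmon X * Bmon X) : BB :=
  (-1) ^+ (degm p.2 * degm q.1) *: bas k (p.1 * q.1, p.2 * q.2)%g.

Fact koszulA s t u :
  bprod koszul (bas k s) (koszul t u) = bprod koszul (koszul s t) (bas k u).
Proof.
rewrite {2}/koszul -bprodZr {3}/koszul -bprodZl !bprodE /koszul /= !degmM.
by rewrite !scalerA -!exprD !mulgA mulnDl mulnDr; congr (_ ^+ _ *: _); lia.
Qed.
Fact koszul1l t : koszul (1%g, 1%g) t = bas k t.
Proof. by case: t => m n; rewrite /koszul /= degm1 mul0n scale1r !mul1g. Qed.
Fact koszul1r t : koszul t (1%g, 1%g) = bas k t.
Proof. by case: t => m n; rewrite /koszul /= degm1 muln0 scale1r !mulg1. Qed.
HB.instance Definition _ := GRing.Zmodule_isPzRing.Build BB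
  (bprodA koszulA) (bprod1l koszul1l) (bprod1r koszul1r)
  (bprodDl koszul) (bprodDr koszul).

Lemma BBZl c (s t : BB) : c *: (s * t) = (c *: s) * t.
Proof. exact: (bprodZl koszul). Qed.
Lemma BBZr c (s t : BB) : c *: (s * t) = s * (c *: t).
Proof. exact: (bprodZr koszul). Qed.
Lemma BB1 : 1 = bas k (1%g, 1%g) :> BB. Proof. by []. Qed.
Lemma BBM p q : (bas k p : BB) * (bas k q : BB) = koszul p q.
Proof. exact: bprodE. Qed.

Definition scalar_mapBB (c : k) : BB := c *: (1 : BB).
Fact scalar_mapBB_is_zmod_morphism : zmod_morphism scalar_mapBB.
Proof. by move=> c d; rewrite /scalar_mapBB scalerBl. Qed.
HB.instance Definition _ := GRing.isZmodMorphism.Build k BB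
  scalar_mapBB scalar_mapBB_is_zmod_morphism.
Fact scalar_mapBB_is_monoid_morphism : monoid_morphism scalar_mapBB.
Proof.
split=> [|c d]; first exact: scale1r.
by rewrite /scalar_mapBB -BBZl mul1r scalerA.
Qed.
HB.instance Definition _ := GRing.isMonoidMorphism.Build k BB
  scalar_mapBB scalar_mapBB_is_monoid_morphism.
Lemma scalar_mapBBM c t : scalar_mapBB c * t = c *: t.
Proof. by rewrite /scalar_mapBB -BBZl mul1r. Qed.
Lemma scalar_mapBBC c t : scalar_mapBB c * t = t * scalar_mapBB c.
Proof. by rewrite scalar_mapBBM /scalar_mapBB -BBZr mulr1. Qed.

Lemma tens_bas m n : (bas k m : Balg) ⊗ (bas k n : Balg) = bas k (m, n).
Proof. by rewrite /tens !lextE. Qed.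
Lemma tensPl c a a' b : (c *: a + a') ⊗ b = c *: (a ⊗ b) + a' ⊗ b.
Proof. exact: lext_is_linear. Qed.
Lemma tensPr c a b b' : a ⊗ (c *: b + b') = c *: (a ⊗ b) + a ⊗ b'.
Proof.
elim/freemod_ind: a => [|d m a IHa]; first by rewrite /tens !linear0 addr0.
rewrite !tensPl IHa /tens !lextE linearP !scalerDr !scalerA mulrC.
by rewrite addrACA.
Qed.

Definition tens_lift (V : lmodType k) (F : Balg -> Balg -> V) : BB -> V :=
  lext (fun p => F (bas k p.1) (bas k p.2)).
Fact tens_lift_is_linear (V : lmodType k) F : linear (@tens_lift V F).
Proof. exact: lext_is_linear. Qed.
HB.instance Definition _ (V : lmodType k) F :=
  GRing.isLinear.Build k BB V _ (@tens_lift V F) (@tens_lift_is_linear V F).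

Lemma tens_liftE (V : lmodType k) (F : Balg -> Balg -> V) :
  (forall b, linear (F^~ b)) -> (forall a, linear (F a)) ->
  forall a b, tens_lift F (a ⊗ b) = F a b.
Proof.
move=> Fl Fr a b.
have F0l c : F 0 c = 0.
  by have := Fl c (-1) 0 0; rewrite scaler0 addr0 scaleN1r addNr.
have F0r c : F c 0 = 0.
  by have := Fr c (-1) 0 0; rewrite scaler0 addr0 scaleN1r addNr.
elim/freemod_ind: a => [|c m a IHa]; first by rewrite /tens !linear0 F0l.
rewrite tensPl tens_lift_is_linear IHa Fl; congr (_ *: _ + _) => {a IHa}.
elim/freemod_ind: b => [|c' n b IHb].
  by rewrite /tens lextE !linear0 F0r.
by rewrite tensPr tens_lift_is_linear IHb Fr tens_bas /tens_lift lextE.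
Qed.

Definition tau (t : BB) : BB :=
  lext (fun p : Bmon X * Bmon X =>
    (-1) ^+ (degm p.1 * degm p.2) *: bas k (p.2, p.1)) t.

Definition Delta_gen (g : X + X) : BB :=
  match g with
  | inl x => genX x ⊗ genX x
  | inr x => genE x ⊗ genX x + 1 ⊗ genE x
  end.

Lemma degX x : degm (\pi_(Bmon X) [:: inl x]) = 0.
Proof. by rewrite /degm epart_pi. Qed.
Lemma degE x : degm (\pi_(Bmon X) [:: inr x]) = 1%N.
Proof. by rewrite /degm epart_pi. Qed.
Let monX x y : (\pi_(Bmon X) [:: inl y] * \pi_(Bmon X) [:: inl (x ◁ y)] =
  \pi_(Bmon X) [:: inl x] * \pi_(Bmon X) [:: inl y])%g.
Proof.
rewrite -!pi_cat; apply/presmonP; exact: (WcongRel [::] [::] (BrelX x y)).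
Qed.
Let monE x y : (\pi_(Bmon X) [:: inl y] * \pi_(Bmon X) [:: inr (x ◁ y)] =
  \pi_(Bmon X) [:: inr x] * \pi_(Bmon X) [:: inl y])%g.
Proof.
rewrite -!pi_cat; apply/presmonP; exact: (WcongRel [::] [::] (BrelE x y)).
Qed.

Fact Delta_rel s t : @Brel X s t ->
  \prod_(g <- s) Delta_gen g = \prod_(g <- t) Delta_gen g.
Proof.
case=> x y; rewrite !big_cons !big_nil !mulr1 /= !tens_bas.
  by rewrite !BBM /koszul /= !degX monX.
rewrite mulrDr mulrDl !BBM /koszul /= !degX degm1 !mul0n !muln0 !scale1r.
by rewrite monX !monE !mulg1 !mul1g.
Qed.

Definition Delta : Balg -> BB := pres_map scalar_mapBBC Delta_rel.
HB.instance Definition _ := GRing.RMorphism.on Delta.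

Fact iota_rel s t : @Arel X s t ->
  \prod_(x <- s) genX x = \prod_(x <- t) genX x.
Proof. by case=> x y; rewrite !big_cons !big_nil !mulr1 genX_rel. Qed.

Definition iota : Aalg -> Balg := pres_map (@scalar_mapC k (Bmon X)) iota_rel.
HB.instance Definition _ := GRing.RMorphism.on iota.

Fact diag_rel s t : @Arel X s t ->
  \prod_(x <- s) (genX x ⊗ genX x) = \prod_(x <- t) (genX x ⊗ genX x).
Proof.
case=> x y; rewrite !big_cons !big_nil !mulr1 !tens_bas.
by rewrite !BBM /koszul /= !degX monX.
Qed.

Definition diag : Aalg -> BB := pres_map scalar_mapBBC diag_rel.
HB.instance Definition _ := GRing.RMorphism.on diag.

Fact augm_comm (c s : k) : (idfun : {rmorphism k -> k}) c * s = s * c.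
Proof. exact: mulrC. Qed.
Fact augm_rel s t : @Arel X s t -> \prod_(x <- s) 1 = \prod_(x <- t) 1 :> k.
Proof. by case=> x y; rewrite !big_cons !big_nil. Qed.

Definition augm : Aalg -> k := pres_map augm_comm augm_rel.
HB.instance Definition _ := GRing.RMorphism.on augm.

(* The left A-modules B, B ⊗^D B and k.  The action of x on B ⊗^D B is the    *)
(* left multiplication by x ⊗ x, i.e. b ⊗ b' |-> xb ⊗ xb', as |x| = 0.        *)
Definition Bmod : Type := restr iota Balg^o.
Definition BBmod : Type := restr diag BB^o.
Definition kmod : Type := restr augm k^o.
HB.instance Definition _ := GRing.Lmodule.on Bmod.
HB.instance Definition _ := GRing.Lmodule.on BBmod.
HB.instance Definition _ := GRing.Lmodule.on kmod.

Definition ebas (xs : seq X) : Balg := \prod_(x <- xs) genE x.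

Local Notation kA := (@scalar_map k (Amon X) : {rmorphism k -> Aalg}).

Lemma iota_pi u :
  iota (bas k (\pi_(Amon X) u)) = bas k (\pi_(Bmon X) (map inl u)).
Proof. by rewrite /iota pres_map_pi -prod_gen big_map. Qed.

Lemma degm_inl u : degm (\pi_(Bmon X) (map inl u)) = 0.
Proof. by rewrite /degm epart_pi; elim: u. Qed.

Lemma diag_pi u : diag (bas k (\pi_(Amon X) u)) =
  bas k (\pi_(Bmon X) (map inl u), \pi_(Bmon X) (map inl u)).
Proof.
rewrite /diag pres_map_pi; elim: u => [|x u IHu]; first by rewrite big_nil.
rewrite big_cons IHu tens_bas BBM /koszul /= degX mul0n scale1r.
by rewrite -(cat1s (inl x) (map inl u)) !pi_cat.
Qed.

Lemma augm_pi u : augm (bas k (\pi_(Amon X) u)) = 1.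
Proof. by rewrite /augm pres_map_pi big1. Qed.

Section Aext.
Context (V : lmodType Aalg) (phi : seq X -> V).

(* The A-linear map with values [phi xs] on the basis [ebas xs] of B: the     *)
(* monomial m equals [apart m] times [ebas (epart m)].                        *)
Definition aext (b : Bmod) : V :=
  lext (V := restr kA V)
    (fun m : Bmon X => (bas k (apart m) : Aalg) *: phi (epart m)) b.

Let aextP (c : k) (a b : Balg) :
  aext (c *: a + b : Balg) = kA c *: aext a + aext b.
Proof. exact: (@lext_is_linear _ _ (restr kA V)). Qed.

Lemma aext_bas m :
  aext (bas k m : Balg) = (bas k (apart m) : Aalg) *: phi (epart m).
Proof. exact: (@lextE _ _ (restr kA V)). Qed.

Let aext0 : aext 0 = 0.
Proof.
have := aextP 1 0 0; rewrite rmorph1 !scale1r addr0 => /eqP.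
by rewrite -subr_eq0 opprD addNKr oppr_eq0 => /eqP.
Qed.

Let aextM (a : Aalg) (b : Balg) : aext (iota a * b : Balg) = a *: aext b.
Proof.
elim/freemod_ind: a => [|c m a IHa].
  by rewrite rmorph0 mul0r scale0r; exact: aext0.
rewrite /iota pres_mapP -/iota mulrDl -mulrA scalar_mapM aextP IHa.
rewrite -[in RHS]scalar_mapM [in RHS]scalerDl -scalerA.
congr (_ *: _ + _) => {a c IHa}; have [u ->] := presmon_surj m.
rewrite iota_pi; elim/freemod_ind: b => [|c n b IHb].
  by rewrite mulr0 aext0 scaler0.
rewrite mulrDr -monoid_algZr !aextP scalerDr IHb; congr (_ + _) => {b IHb}.
rewrite scalerA -scalar_mapC -scalerA; congr (_ *: _).
have [v ->] := presmon_surj n; rewrite monoid_algM -pi_cat !aext_bas.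
rewrite !apart_pi !epart_pi nfw_cat.
have -> : nfw (map inl u) = (u, [::]) by elim: (u) => //= x w ->.
by rewrite pi_cat -monoid_algM -scalerA.
Qed.

Fact aext_is_linear : linear aext.
Proof.
move=> a b b'; rewrite [_ + b'](_ : _ = (1 : k) *: (iota a * b : Balg) + b').
  by rewrite aextP rmorph1 scale1r aextM.
by rewrite scale1r.
Qed.
HB.instance Definition _ :=
  GRing.isLinear.Build Aalg Bmod V _ aext aext_is_linear.

Lemma aextE xs : aext (ebas xs) = phi xs.
Proof.
have -> : ebas xs = bas k (\pi_(Bmon X) (map inr xs)).
  by rewrite -prod_gen big_map.
rewrite aext_bas apart_pi epart_pi.
have -> : nfw (map inr xs) = ([::], xs) by elim: xs => //= x xs ->.
exact: scale1r.
Qed.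
End Aext.

Lemma Bmod_ext (V : lmodType Aalg) (u v : {linear Bmod -> V}) :
  (forall xs, u (ebas xs) = v (ebas xs)) -> u =1 v.
Proof.
have uP (w : {linear Bmod -> V}) (a : Aalg) (b b' : Balg) :
    w (iota a * b + b' : Balg) = a *: w b + w b'.
  exact: (linearP w a b b').
move=> uv b; elim/freemod_ind: b => [|c m b IHb].
  by have := linear0 u; have := linear0 v; move=> v0 u0; rewrite [LHS]u0 [RHS]v0.
have [w ->] := presmon_surj m; rewrite -scalar_mapM.
have -> : scalar_map (Bmon X) c = iota (scalar_map (Amon X) c).
  by rewrite /iota pres_mapZ rmorph1 mulr1.
have -> : bas k (\pi_(Bmon X) w) =
    iota (bas k (\pi_(Amon X) (nfw w).1)) * ebas (nfw w).2 :> Balg.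
  rewrite iota_pi /ebas -(big_map inr xpredT (gen k (@Brel X))) /= prod_gen.
  rewrite monoid_algM -pi_cat; congr (bas k _); exact/presmonP/nfwP.
by rewrite mulrA -rmorphM !uP uv IHb.
Qed.

Definition h_formula (xs : seq X) : BB :=
  \sum_(i < size xs) (-1) ^+ i *:
    ((\prod_(y <- take i xs) tau (Delta (genE y))) *
     (genE (tnth (in_tuple xs) i) ⊗ genE (tnth (in_tuple xs) i)) *
     \prod_(y <- drop i.+1 xs) Delta (genE y)).

Definition h : Bmod -> BBmod := aext (V := BBmod) h_formula.
HB.instance Definition _ := GRing.Linear.on h.

Definition DeltaA : Bmod -> BBmod := Delta.

Lemma Delta_iota a : Delta (iota a) = diag a.
Proof.
apply: (pres_map_uniq scalar_mapBBC diag_rel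
  (f := (Delta \o iota : {rmorphism Aalg -> BB}))) => [c {}a|x] /=.
  by rewrite /iota pres_mapZ rmorphM /= {1}/Delta pres_mapZ rmorph1 mulr1.
by rewrite /iota pres_mapE {1}/Delta pres_mapE.
Qed.

Fact DeltaA_is_linear : linear DeltaA.
Proof.
move=> a b b'; rewrite /DeltaA [LHS]rmorphD; congr (_ + _).
rewrite -[RHS]/(diag a * Delta b) -Delta_iota.
exact: (rmorphM Delta (iota a) b).
Qed.
HB.instance Definition _ :=
  GRing.isLinear.Build Aalg Bmod BBmod _ DeltaA DeltaA_is_linear.
Definition projBB (d : nat) : BB -> BB :=
  lext (fun p : Bmon X * Bmon X =>
    if (degm p.1 + degm p.2 == d)%N then bas k p else 0).
HB.instance Definition _ d := GRing.Linear.on (projBB d).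

Definition homogBB d (t : BB) : Prop := projBB d t = t.

Lemma homogBB_bas m n : homogBB (degm m + degm n)%N (bas k (m, n)).
Proof. by rewrite /homogBB /projBB lextE eqxx. Qed.
Lemma homogBB0 d : homogBB d 0.
Proof. exact: linear0. Qed.
Lemma homogBBD d s t : homogBB d s -> homogBB d t -> homogBB d (s + t).
Proof. by rewrite /homogBB linearD /= => -> ->. Qed.
Lemma homogBBZ d c t : homogBB d t -> homogBB d (c *: t).
Proof. by rewrite /homogBB linearZ /= => ->. Qed.
Lemma homogBB_proj d t : homogBB d (projBB d t).
Proof.
elim/freemod_ind: t => [|c p t IHt]; first by rewrite linear0; apply: homogBB0.
rewrite linearP /=; apply: homogBBD IHt; apply: homogBBZ.
rewrite /projBB lextE; case: eqP => [<-|_]; last exact: homogBB0.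
by case: p => m n; apply: homogBB_bas.
Qed.
Lemma homogBBM d e s t : homogBB d s -> homogBB e t -> homogBB (d + e)%N (s * t).
Proof.
move=> <- <-; elim/freemod_ind: s => [|c p s IHs].
  by rewrite linear0 mul0r; apply: homogBB0.
rewrite linearP /= mulrDl; apply: homogBBD IHs.
rewrite -BBZl; apply: homogBBZ; elim/freemod_ind: t => [|c' q t IHt].
  by rewrite linear0 mulr0; apply: homogBB0.
rewrite linearP /= mulrDr; apply: homogBBD IHt.
rewrite -BBZr; apply: homogBBZ; rewrite /projBB !lextE.
case: eqP => [<-|_]; last by rewrite mul0r; apply: homogBB0.
case: eqP => [<-|_]; last by rewrite mulr0; apply: homogBB0.
rewrite BBM; apply: homogBBZ.
by rewrite addnACA -(degmM p.1) -(degmM p.2); apply: homogBB_bas.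
Qed.

Lemma DeltaE x : Delta (genE x) = genE x ⊗ genX x + 1 ⊗ genE x.
Proof. exact: pres_mapE. Qed.
Lemma DeltaX x : Delta (genX x) = genX x ⊗ genX x.
Proof. exact: pres_mapE. Qed.

Lemma homog_DeltaE x : homogBB 1 (Delta (genE x)).
Proof.
rewrite DeltaE !tens_bas; apply: homogBBD.
  by have := homogBB_bas (\pi_(Bmon X) [:: inr x]) (\pi_(Bmon X) [:: inl x]);
     rewrite degX degE.
by have := homogBB_bas 1%g (\pi_(Bmon X) [:: inr x]); rewrite degm1 degE.
Qed.
Lemma homog_tau d t : homogBB d t -> homogBB d (tau t).
Proof.
move=> <-; elim/freemod_ind: t => [|c p t IHt].
  by rewrite linear0 /tau linear0; apply: homogBB0.
rewrite linearP /= /tau linearP /=; apply: homogBBD IHt; apply: homogBBZ.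
rewrite /projBB lextE; case: eqP => [<-|_]; last by rewrite linear0; apply: homogBB0.
by rewrite lextE addnC; apply: homogBBZ; apply: homogBB_bas.
Qed.
Lemma homog_prod (F : X -> BB) xs :
  (forall x, homogBB 1 (F x)) -> homogBB (size xs) (\prod_(x <- xs) F x).
Proof.
move=> F1; elim: xs => [|x xs IHxs].
  rewrite big_nil BB1; have := homogBB_bas 1%g 1%g; by rewrite degm1.
by rewrite big_cons; apply: (homogBBM (d := 1)).
Qed.

Lemma homog_Delta xs : homogBB (size xs) (Delta (ebas xs)).
Proof. by rewrite rmorph_prod; apply: homog_prod => x; apply: homog_DeltaE. Qed.

Lemma h_ebas xs : h (ebas xs) = h_formula xs.
Proof. exact: aextE. Qed.

Lemma homog_h xs : homogBB (size xs).+1 (h (ebas xs)).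
Proof.
rewrite h_ebas /h_formula; elim/big_ind: _ => [|s t|i _].
- exact: homogBB0.
- exact: homogBBD.
apply: homogBBZ.
have -> : (size xs).+1 = (size (take i xs) + 2 + size (drop i.+1 xs))%N.
  by rewrite size_takel ?size_drop; have := ltn_ord i; lia.
apply: homogBBM; last by apply: homog_prod => x; apply: homog_DeltaE.
apply: homogBBM; first by apply: homog_prod => x; apply/homog_tau/homog_DeltaE.
rewrite tens_bas; set y := tnth _ _.
by have := homogBB_bas (\pi_(Bmon X) [:: inr y]) (\pi_(Bmon X) [:: inr y]);
  rewrite degE.
Qed.
End RackAlgebras.

Notation "a ⊗ b" := (tens a b).
Arguments Delta {k X}.
Arguments DeltaA {k X}.
Arguments tau {k X}.
Arguments h {k X}.
Arguments aext {k X V}.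
Arguments ebas {k X}.

Section Dual.
Context (k : comPzRingType) (U : lmodType k).

Definition scalar_pred : {pred U -> k^o} := fun f => `[< scalar f >].

Fact scalar_pred_closed : submod_closed scalar_pred.
Proof.
split; first by apply/asboolP => a u v /=; rewrite mulr0 addr0.
move=> c f g /asboolP fl /asboolP gl; apply/asboolP => a u v.
rewrite !fctE /= fl gl !scalerDr addrACA; congr (_ + _).
by rewrite mulrDr; congr (_ + _); exact: mulrCA.
Qed.
HB.instance Definition _ :=
  GRing.isSubmodClosed.Build k (U -> k^o) scalar_pred scalar_pred_closed.

Record dual := Dual {dual_val : U -> k^o; _ : dual_val \in scalar_pred}.
HB.instance Definition _ := [isSub for dual_val].
HB.instance Definition _ := [Choice of dual by <:].
HB.instance Definition _ := [SubChoice_isSubLmodule of dual by <:].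

Definition dual_fun (f : dual) : U -> k := dual_val f.
Coercion dual_fun : dual >-> Funclass.

Fact dual_is_scalar (f : dual) : scalar f.
Proof. by case: f => f fP; exact/asboolP. Qed.
HB.instance Definition _ (f : dual) :=
  GRing.isLinear.Build k U k _ (dual_fun f) (dual_is_scalar f).

Lemma dualP (f g : dual) : f =1 g -> f = g.
Proof. by move=> fg; apply/val_inj/funext. Qed.
Lemma dualD (f g : dual) u : (f + g) u = f u + g u.
Proof. by []. Qed.
Lemma dualZ c (f : dual) u : (c *: f) u = c * f u.
Proof. by []. Qed.
End Dual.

Section RackComplex.
Context (k : comPzRingType) (X : rackType).

Definition chain (n : nat) : Type := freemod k (n.-tuple X).
HB.instance Definition _ n := GRing.Lmodule.on (chain n).

(* With 0-based indices, [lift i j] is the j-th index different from i, and   *)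
(* the sign of the i-th term is (-1) ^+ i.+1.                                 *)
Definition face0 n (i : 'I_n.+1) (t : n.+1.-tuple X) : n.-tuple X :=
  [tuple tnth t (lift i j) | j < n].
Definition face1 n (i : 'I_n.+1) (t : n.+1.-tuple X) : n.-tuple X :=
  [tuple if (j < i)%N then tnth t (lift i j) ◁ tnth t i
         else tnth t (lift i j) | j < n].

Definition bd n : chain n.+1 -> chain n :=
  lext (fun t : n.+1.-tuple X =>
    \sum_(i < n.+1) (-1) ^+ i.+1 *: bas k (face0 i t)
    - \sum_(i < n.+1) (-1) ^+ i.+1 *: bas k (face1 i t) : chain n).
HB.instance Definition _ n := GRing.Linear.on (@bd n).

Definition cochain (n : nat) : Type := dual (chain n).
HB.instance Definition _ n := GRing.Lmodule.on (cochain n).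

Fact cobd_subproof n (f : cochain n) : scalar (f \o @bd n).
Proof. by move=> c a b; rewrite /= !linearP. Qed.
Definition cobd n (f : cochain n) : cochain n.+1 :=
  Dual (introT (asboolP _) (cobd_subproof f)).

Fact cobd_is_linear n : linear (@cobd n).
Proof. by move=> c f g; apply: dualP. Qed.
HB.instance Definition _ n :=
  GRing.isLinear.Build k (cochain n) (cochain n.+1) _ (@cobd n)
    (@cobd_is_linear n).

(* The element of Hom_A(B, k) attached to a cochain of degree n, i.e.         *)
(* e_{x_1} ... e_{x_n} |-> f (x_1, ..., x_n), extended by zero to the other   *)
(* degrees of B.                                                              *)
Definition homA n (f : cochain n) : Bmod k X -> kmod k X :=
  aext (V := kmod k X)
    (fun xs => if insub xs is Some t then f (bas k (t : n.-tuple X)) else 0).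
HB.instance Definition _ n f := GRing.Linear.on (@homA n f).

(* The values of [homA f] in k itself, with its ring structure. *)
Definition cochainB n (f : cochain n) (b : Balg k X) : k := homA f b.

Definition of_homA n (u : {linear Bmod k X -> kmod k X}) : cochain n :=
  Dual (introT (asboolP _)
    (lext_is_linear (V := k^o) (fun t : n.-tuple X => u (ebas t)))).

Lemma homA_ebas n (f : cochain n) (t : n.-tuple X) :
  homA f (ebas t) = f (bas k t).
Proof. by rewrite /homA aextE valK. Qed.
Lemma homA_ebas0 n (f : cochain n) xs : size xs != n -> homA f (ebas xs) = 0.
Proof. by move=> nxs; rewrite /homA aextE insubF //; apply: negbTE. Qed.
Lemma homA_bas0 n (f : cochain n) m : degm m != n -> homA f (bas k m) = 0.
Proof.
by move=> nm; rewrite /homA aext_bas insubF ?scaler0 //; apply: negbTE.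
Qed.

Lemma of_homAK n (u : {linear Bmod k X -> kmod k X}) :
  (forall xs, size xs != n -> u (ebas xs) = 0) -> homA (of_homA n u) =1 u.
Proof.
move=> u0; apply: Bmod_ext => xs /=.
have [xsn|nxs] := eqVneq (size xs) n; last by rewrite homA_ebas0 // u0.
have -> : xs = Tuple (introT eqP xsn) by [].
by rewrite homA_ebas; exact: lextE.
Qed.

(* i(f ⊗ g), given on the monomials b, b' of B by                             *)
(* i(f ⊗ g)(b ⊗ b') = (-1)^{|g| |b|} f(b) g(b').                              *)
Definition ihom m n (f : cochain m) (g : cochain n) : BBmod k X -> kmod k X :=
  lext (V := k^o) (fun p : Bmon X * Bmon X =>
    (-1) ^+ (n * degm p.1) *
    ((homA f (bas k p.1) : k) * (homA g (bas k p.2) : k))).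

Fact ihom_is_linear m n (f : cochain m) (g : cochain n) : linear (ihom f g).
Proof.
have ihomP c (s t : BB k X) :
    ihom f g (c *: s + t : BB k X) = c * ihom f g s + ihom f g t :> k.
  exact: (@lext_is_linear _ _ k^o).
have ihom_bas p : ihom f g (bas k p : BB k X) = (-1) ^+ (n * degm p.1) *
    ((homA f (bas k p.1) : k) * (homA g (bas k p.2) : k)) :> k.
  exact: (@lextE _ _ k^o).
have ihom0 : ihom f g (0 : BB k X) = 0 :> k.
  by have := ihomP (-1) 0 0; rewrite scaler0 addr0 mulN1r addNr.
move=> a s t; rewrite -[LHS]/(ihom f g (diag a * s + t : BB k X)).
rewrite -[RHS]/(augm a * ihom f g s + ihom f g t : k).
have -> : diag a * s + t = (1 : k) *: (diag a * s) + t :> BB k X.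
  by rewrite scale1r.
rewrite ihomP mul1r; congr (_ + _) => {t}.
elim/freemod_ind: a => [|c m' a IHa].
  by rewrite !rmorph0 !mul0r ihom0.
rewrite /diag /augm !pres_mapP -/(diag _) -/(augm _) !mulrDl -mulrA.
rewrite scalar_mapBBM ihomP IHa; congr (_ + _) => {a IHa}.
rewrite -mulrA; congr (_ * _) => {c}.
have [u ->] := presmon_surj m'; rewrite diag_pi augm_pi mul1r.
have homAu d (e : cochain d) (q : Bmon X) :
    homA e (bas k (\pi_(Bmon X) (map inl u) * q)%g) = homA e (bas k q).
  rewrite -monoid_algM -iota_pi.
  rewrite [LHS](linearZ_LR (homA e) (bas k (\pi_(Amon X) u)) (bas k q)).
  have augm1 := augm_pi k u.
  by rewrite -[LHS]/(augm (bas k (\pi_(Amon X) u)) * homA e (bas k q) : k) augm1 mul1r.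
elim/freemod_ind: s => [|c p s IHs]; first by rewrite mulr0 ihom0.
rewrite mulrDr -BBZr !ihomP IHs; congr (_ * _ + _).
rewrite BBM /koszul /= degm_inl mul0n scale1r !ihom_bas /= degmM degm_inl.
by rewrite !homAu.
Qed.
HB.instance Definition _ m n (f : cochain m) (g : cochain n) :=
  GRing.isLinear.Build (Aalg k X) (BBmod k X) (kmod k X) _ (ihom f g)
    (ihom_is_linear f g).

Lemma ihom_homog m n (f : cochain m) (g : cochain n) d (t : BB k X) :
  homogBB d t -> d != (m + n)%N -> ihom f g t = 0.
Proof.
have ihomP c (s s' : BB k X) :
    ihom f g (c *: s + s' : BB k X) = c * ihom f g s + ihom f g s' :> k.
  exact: (@lext_is_linear _ _ k^o).
have ihom0 : ihom f g (0 : BB k X) = 0 by exact: linear0.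
move=> <- dmn; elim/freemod_ind: t => [|c p t IHt].
  by rewrite [projBB d 0]linear0 ihom0.
rewrite [projBB d _]linearP /= ihomP IHt addr0.
rewrite /projBB lextE; case: eqP => [dE|_]; last by rewrite ihom0 mulr0.
rewrite [ihom _ _ _](@lextE _ _ k^o).
have [p1|/homA_bas0-> //] := eqVneq (degm p.1) m; last by rewrite mul0r !mulr0.
have [p2|/homA_bas0-> //] := eqVneq (degm p.2) n; last by rewrite !mulr0.
by rewrite -dE p1 p2 eqxx in dmn.
Qed.

Definition cup m n (f : cochain m) (g : cochain n) : cochain (m + n) :=
  of_homA (m + n) (ihom f g \o DeltaA).

(* H(f ⊗ g) = - i(f ⊗ g) ∘ h, of degree m + n - 1; it vanishes if m + n = 0,  *)
(* where the truncated predecessor gives the degree 0.                        *)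
Definition htpy m n (f : cochain m) (g : cochain n) : cochain (m + n).-1 :=
  of_homA (m + n).-1 (\- (ihom f g \o h)).

Lemma homA_cup m n (f : cochain m) (g : cochain n) b :
  homA (cup f g) b = ihom f g (Delta b).
Proof.
apply: of_homAK => xs nxs /=; apply: (ihom_homog _ _ _ nxs).
exact: homog_Delta.
Qed.

Lemma homA_htpy m n (f : cochain m) (g : cochain n) b :
  homA (htpy f g) b = - ihom f g (h b).
Proof.
apply: of_homAK => xs nxs /=.
case: xs nxs => [|x xs] nxs.
  by rewrite h_ebas /h_formula big_ord0 linear0 oppr0.
rewrite (ihom_homog _ _ (@homog_h k X (x :: xs))) ?oppr0 //=.
by move: nxs => /=; lia.
Qed.

(* Bilinearity: cup and htpy factor through the tensor product of cochains.   *)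
Fact homAP n c (f f' : cochain n) b :
  homA (c *: f + f') b = c * homA f b + homA f' b :> k.
Proof.
have homADZ d (e : cochain n) a (x y : Balg k X) :
    homA e (d *: (iota a * x) + y : Balg k X) =
    d * (augm a * homA e x) + homA e y :> k.
  rewrite -scalar_mapM (_ : scalar_map _ d = iota (scalar_map (Amon X) d)).
    have := linearP (homA e) (scalar_map (Amon X) d) (iota a * x : Balg k X) y.
    rewrite -[X in X = _]/(homA e (iota (scalar_map (Amon X) d) * (iota a * x) + y : Balg k X)).
    move=> ->; congr (_ + _).
    rewrite -[LHS]/(augm (scalar_map (Amon X) d) * homA e (iota a * x : Balg k X) : k).
    rewrite /augm pres_mapZ rmorph1 mulr1; congr (_ * _).
    exact: (linearZ_LR (homA e) a x).
  by rewrite /iota pres_mapZ rmorph1 mulr1.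
have homA0 (e : cochain n) : homA e (0 : Balg k X) = 0 by exact: linear0.
elim/freemod_ind: b => [|d m b IHb]; first by rewrite !homA0 mulr0 addr0.
have [w ->] := presmon_surj m.
have -> : bas k (\pi_(Bmon X) w) =
    iota (bas k (\pi_(Amon X) (nfw w).1)) * ebas (nfw w).2 :> Balg k X.
  rewrite iota_pi /ebas -(big_map inr xpredT (gen k (@Brel X))) /= prod_gen.
  by rewrite monoid_algM -pi_cat; congr (bas k _); exact/presmonP/nfwP.
rewrite !homADZ IHb; set xs := (nfw w).2.
have -> : homA (c *: f + f') (ebas xs) =
    c * homA f (ebas xs) + homA f' (ebas xs) :> k.
  rewrite /homA !aextE; case: insubP => [t _ _|_]; last by rewrite mulr0 addr0.
  by [].
by rewrite !mulrDr addrACA; congr (_ + _ + _); rewrite !(mulrCA c).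
Qed.

Fact ihomPl m n c (f f' : cochain m) (g : cochain n) t :
  ihom (c *: f + f') g t = c * ihom f g t + ihom f' g t :> k.
Proof.
have ihomP (e : cochain m) d (s s' : BB k X) :
    ihom e g (d *: s + s' : BB k X) = d * ihom e g s + ihom e g s' :> k.
  exact: (@lext_is_linear _ _ k^o).
have ihom0 (e : cochain m) : ihom e g (0 : BB k X) = 0 by exact: linear0.
have ihom_bas (e : cochain m) p : ihom e g (bas k p : BB k X) =
    (-1) ^+ (n * degm p.1) *
    ((homA e (bas k p.1) : k) * (homA g (bas k p.2) : k)) :> k.
  exact: (@lextE _ _ k^o).
elim/freemod_ind: t => [|d p t IHt]; first by rewrite !ihom0 mulr0 addr0.
rewrite !ihomP IHt !ihom_bas homAP !mulrDl !mulrDr addrACA.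
by congr (_ + _ + _); rewrite -mulrA !(mulrCA c).
Qed.

Fact ihomPr m n c (f : cochain m) (g g' : cochain n) t :
  ihom f (c *: g + g') t = c * ihom f g t + ihom f g' t :> k.
Proof.
have ihomP (e : cochain n) d (s s' : BB k X) :
    ihom f e (d *: s + s' : BB k X) = d * ihom f e s + ihom f e s' :> k.
  exact: (@lext_is_linear _ _ k^o).
have ihom0 (e : cochain n) : ihom f e (0 : BB k X) = 0 by exact: linear0.
have ihom_bas (e : cochain n) p : ihom f e (bas k p : BB k X) =
    (-1) ^+ (n * degm p.1) *
    ((homA f (bas k p.1) : k) * (homA e (bas k p.2) : k)) :> k.
  exact: (@lextE _ _ k^o).
elim/freemod_ind: t => [|d p t IHt]; first by rewrite !ihom0 mulr0 addr0.
rewrite !ihomP IHt !ihom_bas homAP !mulrDr addrACA.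
by congr (_ + _ + _); rewrite !(mulrCA c).
Qed.

Fact homA_inj n (f g : cochain n) : homA f =1 homA g -> f = g.
Proof.
move=> fg; apply: dualP; elim/freemod_ind => [|c t a IHa].
  by rewrite [LHS]linear0 [RHS]linear0.
by rewrite [LHS]linearP [RHS]linearP /= IHa -!homA_ebas fg.
Qed.

Lemma cupPl m n c (f f' : cochain m) (g : cochain n) :
  cup (c *: f + f') g = c *: cup f g + cup f' g.
Proof. by apply: homA_inj => b; rewrite homAP !homA_cup ihomPl. Qed.
Lemma cupPr m n c (f : cochain m) (g g' : cochain n) :
  cup f (c *: g + g') = c *: cup f g + cup f g'.
Proof. by apply: homA_inj => b; rewrite homAP !homA_cup ihomPr. Qed.
Lemma htpyPl m n c (f f' : cochain m) (g : cochain n) :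
  htpy (c *: f + f') g = c *: htpy f g + htpy f' g.
Proof.
by apply: homA_inj => b; rewrite homAP !homA_htpy ihomPl opprD mulrN.
Qed.
Lemma htpyPr m n c (f : cochain m) (g g' : cochain n) :
  htpy f (c *: g + g') = c *: htpy f g + htpy f g'.
Proof.
by apply: homA_inj => b; rewrite homAP !homA_htpy ihomPr opprD mulrN.
Qed.

Definition cocycle_pred n : {pred cochain n} := fun f => cobd f == 0.
Fact cocycle_pred_closed n : submod_closed (@cocycle_pred n).
Proof.
split; first by rewrite unfold_in linear0.
by move=> c f g; rewrite !unfold_in linearP /= => /eqP-> /eqP->; rewrite scaler0 addr0.
Qed.
HB.instance Definition _ n := GRing.isSubmodClosed.Build k (cochain n)
  (@cocycle_pred n) (@cocycle_pred_closed n).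

Record cocycle n :=
  Cocycle {cocycle_val :> cochain n; _ : cocycle_val \in @cocycle_pred n}.
HB.instance Definition _ n := [isSub for @cocycle_val n].
HB.instance Definition _ n := [Choice of cocycle n by <:].
HB.instance Definition _ n := [SubChoice_isSubLmodule of cocycle n by <:].

Definition is_coboundary n : cochain n -> Prop :=
  match n with
  | 0 => fun f => f = 0
  | n'.+1 => fun f => exists g : cochain n', f = cobd g
  end.
Definition coboundary_pred n : {pred cocycle n} :=
  fun f => `[< is_coboundary (f : cochain n) >].
Fact coboundary_pred_closed n : submod_closed (@coboundary_pred n).
Proof.
split=> [|c f g]; rewrite ?unfold_in.
  by apply/asboolP; case: n => [//|n]; exists 0; rewrite linear0.
move=> /asboolP fB /asboolP gB; apply/asboolP; move: fB gB.
case: n f g => [|n] f g /=; first by move=> -> ->; rewrite scaler0 addr0.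
by move=> [f' ->] [g' ->]; exists (c *: f' + g'); rewrite linearP.
Qed.
HB.instance Definition _ n := GRing.isSubmodClosed.Build k (cocycle n)
  (@coboundary_pred n) (@coboundary_pred_closed n).

Definition cohomology n : Type := Quotient.quot (@coboundary_pred n).
HB.instance Definition _ n := GRing.Zmodule.on (cohomology n).
HB.instance Definition _ n := EqQuotient.on (cohomology n).

Definition cohomology_scale n (c : k) (a : cohomology n) : cohomology n :=
  \pi_(cohomology n) (c *: repr a).
Fact cohomology_scaleE n c (f : cocycle n) :
  cohomology_scale c (\pi_(cohomology n) f) = \pi_(cohomology n) (c *: f).
Proof.
apply/eqP; rewrite /cohomology_scale -Quotient.idealrBE -scalerBr.
by apply: rpredZ; rewrite Quotient.idealrBE reprK.
Qed.
Fact cohomology_surj n (a : cohomology n) :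
  exists f, a = \pi_(cohomology n) f.
Proof. by exists (repr a); rewrite reprK. Qed.
Fact cohomologyD n (f g : cocycle n) :
  \pi_(cohomology n) (f + g) = \pi_(cohomology n) f + \pi_(cohomology n) g.
Proof. exact: (Quotient.pi_add (@coboundary_pred n)). Qed.

Fact cohomology_scaleA n c d (a : cohomology n) :
  cohomology_scale c (cohomology_scale d a) = cohomology_scale (c * d) a.
Proof.
by have [f ->] := cohomology_surj a; rewrite !cohomology_scaleE scalerA.
Qed.
Fact cohomology_scale1 n : left_id 1 (@cohomology_scale n).
Proof.
by move=> a; have [f ->] := cohomology_surj a; rewrite cohomology_scaleE scale1r.
Qed.
Fact cohomology_scaleDr n : right_distributive (@cohomology_scale n) +%R.
Proof.
move=> c a b.
have [[f ->] [g ->]] := conj (cohomology_surj a) (cohomology_surj b).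
by rewrite -cohomologyD !cohomology_scaleE scalerDr cohomologyD.
Qed.
Fact cohomology_scaleDl n a :
  {morph (@cohomology_scale n)^~ a : c d / c + d}.
Proof.
move=> c d; have [f ->] := cohomology_surj a.
by rewrite !cohomology_scaleE scalerDl cohomologyD.
Qed.
HB.instance Definition _ n := GRing.Zmodule_isLmodule.Build k (cohomology n)
  (@cohomology_scaleA n) (@cohomology_scale1 n)
  (@cohomology_scaleDr n) (@cohomology_scaleDl n).
End RackComplex.

Arguments bd {k X n}.
Arguments homA {k X n}.
Arguments cochainB {k X n}.

(* Main.v *)
From HB Require Import structures.
Require Import Defs.
From mathcomp Require Import all_boot ssralg ring_quotient.
From mathcomp Require Import boolp zify.

Set Implicit Arguments.
Unset Strict Implicit.
Unset Printing Implicit Defensive.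

Import GRing.Theory.
Local Open Scope ring_scope.
Local Open Scope quotient_scope.

(** The rack complex is B seen through its augmentation. Let d be the
super-derivation of B of degree -1 with d(x) = 0 and d(e_x) = x - 1. Its
Leibniz expansion on e_{x_1} ... e_{x_n}, followed by moving each x_i to the
left by means of e_y x = x e_{y^x}, gives exactly the two families of faces, so
the coboundary of f is f o d ([cochainB_cobd]). On B ⊗ B let
D = d ⊗ 1 + 1 ⊗ d with the Koszul sign. Two identities in B ⊗ B carry the proof:
- D Delta = Delta d ([dBB_Delta]), which makes the cup product a chain map;
- D h + h d = tau Delta - Delta ([dBB_hB]), which makes h a homotopy.

Both identities are checked on generators. The maps d and h (and D to the left
of suitable elements) satisfy a Leibniz rule for left multiplication by a
generator:
  d(x b) = x d(b),            d(e_x b) = (x - 1) b - e_x d(b),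
  h(x b) = (x ⊗ x) h(b),      h(e_x b) = (e_x ⊗ e_x) Delta(b) - (tau Delta)(e_x) h(b).
Since B is generated by the x and the e_x, two linear maps with the same value
at 1 and the same recursion for left multiplication by generators coincide
([Balg_gen_ext]). For the second identity, the two sides satisfy the same
recursion because D(e_x ⊗ e_x) = (tau Delta - Delta)(e_x), while both
Delta(e_x) and (tau Delta)(e_x) have differential x ⊗ x - 1. The rules for d
and h are instances of one statement, [tder_genE], about derivations twisted by
a pair of morphisms.

Applying i(f ⊗ g) to these identities gives the theorem: with df = f o d,
i(f ⊗ g) o D is i((-1)^|g| df ⊗ g + f ⊗ dg) ([ihomB_dBB]), and i(f ⊗ g) o tau is
(-1)^{|f||g|} i(g ⊗ f) ([ihomB_tau]). The first identity shows that the
cup product descends to cohomology, and the homotopy formula on cocycles gives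
graded commutativity. *)

(* The name iota otherwise refers to the enumeration of natural numbers. *)
Local Notation iota := Defs.iota.

(** * Generators and normal forms *)

Section Words.
Context (k : comPzRingType) (X : rackType).
Local Notation B := (Balg k X).

(** B is spanned by the words in the x and e_x, and a word is peeled off from
the left; this is the form in which all identities below are proved. *)
Lemma Balg_gen_ext (V : lmodType k) (u v : {linear B -> V}) :
  u 1 = v 1 ->
  (forall x b, u b = v b -> u (genX k x * b) = v (genX k x * b)) ->
  (forall x b, u b = v b -> u (genE k x * b) = v (genE k x * b)) ->
  u =1 v.
Proof.
move=> uv1 uvX uvE; apply: (@freemod_ext k (Bmon X) V u v) => m.
have [w ->] := presmon_surj m; rewrite -(prod_gen k).
elim: w => [|[x|x] w IHw]; first by rewrite big_nil.
  by rewrite big_cons; apply: uvX.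
by rewrite big_cons; apply: uvE.
Qed.

Lemma ebas_pi xs : ebas xs = bas k (\pi_(Bmon X) (map inr xs)) :> B.
Proof. by rewrite -(prod_gen k (@Brel X)) big_map. Qed.

Lemma bas_normal w : bas k (\pi_(Bmon X) w) =
  iota (bas k (\pi_(Amon X) (nfw w).1)) * ebas (nfw w).2 :> B.
Proof.
by rewrite iota_pi ebas_pi monoid_algM -pi_cat; congr (bas k _); apply/presmonP/nfwP.
Qed.

Lemma iota_genA (x : X) : iota (genA k x) = genX k x.
Proof. exact: pres_mapE. Qed.
Lemma diag_genA (x : X) : diag (genA k x) = genX k x ⊗ genX k x.
Proof. exact: pres_mapE. Qed.
Lemma iota_scalar c : iota (scalar_map (Amon X) c) = scalar_map (Bmon X) c :> B.
Proof. by rewrite /iota pres_mapZ rmorph1 mulr1. Qed.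
Lemma diag_scalar c : diag (scalar_map (Amon X) c) = scalar_mapBB X c :> BB k X.
Proof. by rewrite /diag pres_mapZ rmorph1 mulr1. Qed.

End Words.

(** * Twisted derivations of B *)

(** Iterates the relation for one letter along a word u: this moves a scalar
from A across gam x, at the price of acting on x by u. *)
Lemma twist_racts (k : comPzRingType) (X : rackType) (S : pzRingType)
    (f : {rmorphism Aalg k X -> S}) (gam : X -> S) :
  (forall x y, f (genA k y) * gam (x ◁ y) = gam x * f (genA k y)) ->
  forall u x, f (bas k (\pi_(Amon X) u)) * gam (racts x u) =
              gam x * f (bas k (\pi_(Amon X) u)).
Proof.
move=> gamJ u; rewrite -(prod_gen k (@Arel X)); elim: u => [|y u IHu] x.
  by rewrite big_nil rmorph1 mul1r mulr1.
rewrite big_cons rmorphM -mulrA [racts _ _]/= (IHu (x ◁ y)).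
by rewrite !mulrA gamJ.
Qed.

Section TwistedDerivation.
Context (k : comPzRingType) (X : rackType) (S : pzRingType).
Context (f : {rmorphism Aalg k X -> S}) (rho : {rmorphism Balg k X -> S}).
Context (alpha beta : X -> S).
Hypothesis rho_iota : forall a, rho (iota a) = f a.
Hypothesis f_scalarC : forall c s,
  f (scalar_map (Amon X) c) * s = s * f (scalar_map (Amon X) c).
Hypothesis alphaJ : forall x y,
  f (genA k y) * alpha (x ◁ y) = alpha x * f (genA k y).
Hypothesis betaJ : forall x y,
  f (genA k y) * beta (x ◁ y) = beta x * f (genA k y).

(** The Leibniz expansion on e_{x_1} ... e_{x_n} of the map which is
alpha on the generators e_x, zero on the generators x, and a super-derivation
with values in the bimodule where B acts on the right by rho and on the left by
the morphism sending e_x to beta x. *)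
Definition tder_formula (xs : seq X) : S :=
  \sum_(i < size xs) (-1) ^+ i *
    ((\prod_(y <- take i xs) beta y) * alpha (tnth (in_tuple xs) i) *
     \prod_(y <- drop i.+1 xs) rho (genE k y)).

Lemma tder_formula_cons x xs : tder_formula (x :: xs) =
  alpha x * rho (ebas xs) - beta x * tder_formula xs.
Proof.
rewrite /tder_formula big_ord_recl /= expr0 mul1r big_nil mul1r drop0.
rewrite (tnth_nth x) /= rmorph_prod; congr (_ + _).
rewrite mulr_sumr -sumrN; apply: eq_bigr => i _ /=.
rewrite /bump leq0n add1n exprS mulN1r mulNr /= big_cons.
rewrite (tnth_nth x) (tnth_nth x (in_tuple xs)) /=; congr (- _).
by rewrite !mulrA -(commr_sign (beta x)).
Qed.

Context (phi : seq X -> S).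
Hypothesis phi_formula : phi =1 tder_formula.

Definition tder (b : Balg k X) : S := aext (V := restr f S^o) phi b.

Lemma tderP a (b b' : Balg k X) :
  tder (iota a * b + b') = f a * tder b + tder b'.
Proof. exact: (linearP (aext (V := restr f S^o) phi) a b b'). Qed.

Lemma tder0 : tder 0 = 0.
Proof. exact: (linear0 (aext (V := restr f S^o) phi)). Qed.

Lemma tderM a (b : Balg k X) : tder (iota a * b) = f a * tder b.
Proof. by rewrite -[iota a * b]addr0 tderP tder0 addr0. Qed.

Lemma tder_genX x b : tder (genX k x * b) = f (genA k x) * tder b.
Proof. by rewrite -iota_genA tderM. Qed.

Lemma tderZ c (b b' : Balg k X) :
  tder (c *: b + b') = f (scalar_map (Amon X) c) * tder b + tder b'.
Proof. by rewrite -scalar_mapM -iota_scalar tderP. Qed.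

Lemma rhoZ c (b b' : Balg k X) :
  rho (c *: b + b') = f (scalar_map (Amon X) c) * rho b + rho b'.
Proof. by rewrite -scalar_mapM -iota_scalar rmorphD rmorphM rho_iota. Qed.

(** The Leibniz rule holds by construction on the basis of B over A. It extends
to all of B because e_x u = u e_{x^u} for u in A, and because alpha and beta
obey the same commutation as e_x. *)
Lemma tder_genE x b :
  tder (genE k x * b) = alpha x * rho b - beta x * tder b.
Proof.
elim/freemod_ind: b => [|c m b IHb].
  by rewrite mulr0 tder0 !raddf0 !mulr0 subr0.
rewrite mulrDr -monoid_algZr !tderZ IHb rhoZ !mulrDr !mulrA -!f_scalarC.
rewrite opprD addrACA -!mulrA -mulrBr; congr (_ * _ + _) => {b IHb}.
have [w ->] := presmon_surj m; rewrite bas_normal.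
set u := (nfw w).1; set ys := (nfw w).2.
have -> : genE k x * (iota (bas k (\pi_(Amon X) u)) * ebas ys) =
    iota (bas k (\pi_(Amon X) u)) * ebas (racts x u :: ys) :> Balg k X.
  rewrite /ebas big_cons !mulrA; congr (_ * _).
  have iotaJ (y z : X) : iota (genA k z) * genE k (y ◁ z) = genE k y * iota (genA k z).
    by rewrite !iota_genA genE_rel.
  by rewrite -(twist_racts (f := @Defs.iota k X) iotaJ u x).
rewrite !tderM rmorphM rho_iota.
have tder_ebas zs : tder (ebas zs) = tder_formula zs.
  by rewrite -phi_formula; exact: (aextE (V := restr f S^o)).
rewrite !tder_ebas tder_formula_cons mulrBr !mulrA.
by rewrite !twist_racts.
Qed.

End TwistedDerivation.

(** * The differential of B *)

Section Differential.
Context (k : comPzRingType) (X : rackType).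
Local Notation B := (Balg k X).
Local Notation BB := (BB k X).
Implicit Types (x y : X) (a b : B) (s t : BB).

Definition dformula : seq X -> B :=
  tder_formula (idfun : {rmorphism B -> B}) (fun x => genX k x - 1) (@genE k X).

Definition dB (b : B) : B := tder (@iota k X) dformula b.

Fact iota_scalarC c b :
  iota (scalar_map (Amon X) c) * b = b * iota (scalar_map (Amon X) c).
Proof. by rewrite iota_scalar scalar_mapC. Qed.

Fact diag_scalarC c s :
  diag (scalar_map (Amon X) c) * s = s * diag (scalar_map (Amon X) c).
Proof. by rewrite diag_scalar scalar_mapBBC. Qed.

Fact dB_is_linear : linear dB.
Proof. by move=> c b b'; rewrite /dB tderZ /= iota_scalar scalar_mapM. Qed.
HB.instance Definition _ := GRing.isLinear.Build k B B _ dB dB_is_linear.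

Lemma dB_genX x b : dB (genX k x * b) = genX k x * dB b.
Proof. by rewrite /dB tder_genX /= iota_genA. Qed.

Lemma dB_genE x b : dB (genE k x * b) = (genX k x - 1) * b - genE k x * dB b.
Proof.
apply: (tder_genE (rho := idfun : {rmorphism B -> B}) (alpha := fun x => genX k x - 1)) => //.
- exact: iota_scalarC.
- by move=> y z; rewrite /= iota_genA mulrBr mulrBl genX_rel mulr1 mul1r.
- by move=> y z; rewrite /= iota_genA genE_rel.
Qed.

Lemma dB1 : dB 1 = 0.
Proof.
have -> : 1 = ebas [::] :> B by rewrite /ebas big_nil.
rewrite /dB /tder [LHS](aextE (V := restr (@iota k X) B^o)).
by rewrite /dformula /tder_formula big_ord0.
Qed.

(** The sign automorphism b |-> (-1)^|b| b: it expresses the Koszul signs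
without restricting to homogeneous elements. *)
Definition parity (b : B) : B := lext (fun m : Bmon X => (-1) ^+ degm m *: bas k m : B) b.
Fact parity_is_linear : linear parity.
Proof. exact: lext_is_linear. Qed.
HB.instance Definition _ := GRing.isLinear.Build k B B _ parity parity_is_linear.

Lemma parity_bas (m : Bmon X) : parity (bas k m) = (-1) ^+ degm m *: bas k m.
Proof. exact: lextE. Qed.

Lemma parityM a b : parity (a * b) = parity a * parity b.
Proof.
elim/freemod_ind: a => [|c m a IHa]; first by rewrite mul0r linear0 mul0r.
rewrite mulrDl -monoid_algZl !linearP /= IHa mulrDl -monoid_algZl; congr (_ *: _ + _) => {a IHa}.
elim/freemod_ind: b => [|c' n b IHb]; first by rewrite mulr0 linear0 mulr0.
rewrite mulrDr -monoid_algZr !linearP /= IHb mulrDr -monoid_algZr; congr (_ *: _ + _).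
rewrite monoid_algM !parity_bas -monoid_algZl -monoid_algZr monoid_algM scalerA.
by rewrite degmM exprD.
Qed.

Lemma parity_genX x : parity (genX k x) = genX k x.
Proof. by rewrite [LHS]parity_bas degX scale1r. Qed.
Lemma parity_genE x : parity (genE k x) = - genE k x.
Proof. by rewrite [LHS]parity_bas degE expr1 scaleN1r. Qed.
Lemma parity1 : parity 1 = 1.
Proof. by rewrite monoid_alg1 [LHS]parity_bas degm1 scale1r. Qed.
Lemma parityK b : parity (parity b) = b.
Proof.
elim/freemod_ind: b => [|c m b IHb]; first by rewrite !linear0.
rewrite !linearP /= IHb parity_bas linearZ /= parity_bas; congr (_ *: _ + _).
by rewrite scalerA -expr2 sqrr_sign scale1r.
Qed.

(** Encodes that d has odd degree. *)
Lemma dB_parity b : dB (parity b) = - parity (dB b).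
Proof.
pose u : {linear B -> B} := dB \o parity.
pose v : {linear B -> B} := \- (parity \o dB).
apply: (@Balg_gen_ext k X _ u v) => [|x {}b|x {}b] /=.
- by rewrite parity1 dB1 linear0 oppr0.
- by rewrite !dB_genX !parityM parity_genX dB_genX => ->; rewrite mulrN.
rewrite parityM parity_genE mulNr linearN /= !dB_genE => ->.
rewrite [parity (_ - _)]linearB /= !parityM [parity (_ - _)]linearB /= parity_genX parity1 parity_genE.
by rewrite mulrN mulNr !opprK.
Qed.

End Differential.

(** * The differential of the tensor square *)

Section TensorDifferential.
Context (k : comPzRingType) (X : rackType).
Local Notation B := (Balg k X).
Local Notation BB := (BB k X).
Implicit Types (x y : X) (a b : B) (s t : BB).

Lemma tens_linear_r a : linear (fun b => a ⊗ b).
Proof. by move=> c b b'; apply: tensPr. Qed.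
HB.instance Definition _ a :=
  GRing.isLinear.Build k B BB _ (tens a) (tens_linear_r a).

Lemma tensDl a a' b : (a + a') ⊗ b = a ⊗ b + a' ⊗ b.
Proof. by rewrite -[a in LHS]scale1r tensPl scale1r. Qed.
Lemma tens0l b : 0 ⊗ b = 0.
Proof. by apply: (addrI (0 ⊗ b)); rewrite -tensDl !addr0. Qed.
Lemma tensNl a b : (- a) ⊗ b = - (a ⊗ b).
Proof. by apply/eqP; rewrite -addr_eq0 -tensDl addNr tens0l. Qed.
Lemma tensBl a a' b : (a - a') ⊗ b = a ⊗ b - a' ⊗ b.
Proof. by rewrite tensDl tensNl. Qed.
Lemma tensZl c a b : (c *: a) ⊗ b = c *: (a ⊗ b).
Proof. by rewrite -[c *: a]addr0 tensPl tens0l addr0. Qed.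

Lemma tens_ext (V : lmodType k) (u v : {linear BB -> V}) :
  (forall a b, u (a ⊗ b) = v (a ⊗ b)) -> u =1 v.
Proof.
move=> uv; apply: (@freemod_ext k (Bmon X * Bmon X)%type V u v) => -[m n].
by rewrite -tens_bas uv.
Qed.

Lemma tens11 : 1 ⊗ 1 = 1 :> BB.
Proof. exact: tens_bas. Qed.

(** The Koszul sign comes from moving a past the monomial n, hence the parity
operator is applied once per factor e_x of n. *)
Lemma tensM_bas (m n : Bmon X) a b :
  ((bas k m : B) ⊗ (bas k n : B)) * (a ⊗ b) =
  ((bas k m : B) * iter (degm n) (@parity k X) a) ⊗ ((bas k n : B) * b).
Proof.
have iter_parity c j a' a'' : iter j (@parity k X) (c *: a' + a'') =
    c *: iter j (@parity k X) a' + iter j (@parity k X) a''.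
  by elim: j => //= j ->; rewrite linearP.
have iter_parity0 j : iter j (@parity k X) 0 = 0.
  by elim: j => //= j ->; rewrite linear0.
elim/freemod_ind: a => [|c p a IHa].
  by rewrite iter_parity0 mulr0 !tens0l mulr0.
rewrite iter_parity mulrDr -monoid_algZr !tensPl mulrDr -BBZr IHa.
congr (_ *: _ + _) => {a IHa}.
elim/freemod_ind: b => [|c' q b IHb].
  by rewrite mulr0 !linear0 mulr0.
rewrite mulrDr -monoid_algZr !linearP /= mulrDr -BBZr IHb.
congr (_ *: _ + _) => {b IHb}.
have -> : iter (degm n) (@parity k X) (bas k p) =
    (-1) ^+ (degm n * degm p) *: bas k p.
  elim: (degm n) => [|j /= ->]; first by rewrite mul0n scale1r.
  by rewrite linearZ /= parity_bas scalerA -exprD mulSn addnC.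
by rewrite -monoid_algZr tensZl !monoid_algM !tens_bas BBM.
Qed.

Lemma tensMl_genX x a b : (genX k x ⊗ 1) * (a ⊗ b) = (genX k x * a) ⊗ b.
Proof. by rewrite /genX monoid_alg1 tensM_bas degm1 -monoid_alg1 mul1r. Qed.
Lemma tensMl_genE x a b : (genE k x ⊗ 1) * (a ⊗ b) = (genE k x * a) ⊗ b.
Proof. by rewrite /genE monoid_alg1 tensM_bas degm1 -monoid_alg1 mul1r. Qed.
Lemma tensMr_genX x a b : (1 ⊗ genX k x) * (a ⊗ b) = a ⊗ (genX k x * b).
Proof. by rewrite /genX monoid_alg1 tensM_bas degX -monoid_alg1 mul1r. Qed.
Lemma tensMr_genE x a b : (1 ⊗ genE k x) * (a ⊗ b) = parity a ⊗ (genE k x * b).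
Proof. by rewrite /genE monoid_alg1 tensM_bas degE -monoid_alg1 mul1r. Qed.

Definition dBB : BB -> BB := tens_lift (fun a b => dB a ⊗ b + parity a ⊗ dB b).
HB.instance Definition _ := GRing.Linear.on dBB.

Lemma dBB_tens a b : dBB (a ⊗ b) = dB a ⊗ b + parity a ⊗ dB b.
Proof.
apply: tens_liftE => [b' c a1 a2|a' c b1 b2].
  by rewrite !linearP /= !tensPl scalerDr addrACA.
by rewrite !linearP /= scalerDr addrACA.
Qed.

(** With D the differential of B ⊗ B, the rule D(s t) = s' t + e s D(t): here s'
stands for D(s) and e for the sign (-1)^|s|. Stating the rule for one left
factor s at a time avoids proving that D is a derivation, and it suffices for
recursions on left multiplication by generators. *)
Definition left_leibniz (e : k) s s' :=
  forall t, dBB (s * t) = s' * t + e *: (s * dBB t).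

Lemma left_leibnizD e s1 s1' s2 s2' :
  left_leibniz e s1 s1' -> left_leibniz e s2 s2' ->
  left_leibniz e (s1 + s2) (s1' + s2').
Proof.
move=> l1 l2 t; rewrite mulrDl linearD /= l1 l2 !mulrDl scalerDr.
by rewrite addrACA.
Qed.

Lemma left_leibnizM e1 s1 s1' e2 s2 s2' :
  left_leibniz e1 s1 s1' -> left_leibniz e2 s2 s2' ->
  left_leibniz (e1 * e2) (s1 * s2) (s1' * s2 + e1 *: (s1 * s2')).
Proof.
move=> l1 l2 t; rewrite -mulrA l1 l2 mulrDr scalerDr -BBZr scalerA.
by rewrite mulrDl -BBZl !mulrA addrA.
Qed.

Let mulBB s t : BB := s * t.
Let mulBB_is_linear s : linear (mulBB s).
Proof. by move=> c t t'; rewrite /mulBB mulrDr -BBZr. Qed.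
HB.instance Definition _ s :=
  GRing.isLinear.Build k BB BB _ (mulBB s) (mulBB_is_linear s).

Lemma left_leibniz_tens e s s' :
  (forall a b, dBB (s * (a ⊗ b)) = s' * (a ⊗ b) + e *: (s * dBB (a ⊗ b))) ->
  left_leibniz e s s'.
Proof.
move=> st t.
have eq2 : (dBB \o mulBB s : {linear BB -> BB}) =1
    (mulBB s' \+ (e \*: (mulBB s \o dBB)) : {linear BB -> BB}).
  by apply: tens_ext => a b; exact: st.
exact: eq2.
Qed.

Lemma left_leibniz_Xl x : left_leibniz 1 (genX k x ⊗ 1) 0.
Proof.
apply: left_leibniz_tens => a b; rewrite mul0r add0r scale1r.
rewrite tensMl_genX !dBB_tens mulrDr !tensMl_genX dB_genX parityM parity_genX.
by [].
Qed.

Lemma left_leibniz_Xr x : left_leibniz 1 (1 ⊗ genX k x) 0.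
Proof.
apply: left_leibniz_tens => a b; rewrite mul0r add0r scale1r.
by rewrite tensMr_genX !dBB_tens mulrDr !tensMr_genX dB_genX.
Qed.

Lemma left_leibniz_El x :
  left_leibniz (-1) (genE k x ⊗ 1) (genX k x ⊗ 1 - 1).
Proof.
apply: left_leibniz_tens => a b; rewrite scaleN1r.
rewrite tensMl_genE !dBB_tens mulrDr !tensMl_genE dB_genE parityM parity_genE.
rewrite !mulrBl !mul1r tensMl_genX mulNr tensNl !tensBl.
by rewrite opprD !addrA.
Qed.

(** The Koszul sign enters here: moving e_x past a applies the parity operator
to a, and the sign -1 of the rule is the one with which that operator
anticommutes with d. *)
Lemma left_leibniz_Er x :
  left_leibniz (-1) (1 ⊗ genE k x) (1 ⊗ genX k x - 1).
Proof.
apply: left_leibniz_tens => a b; rewrite scaleN1r.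
rewrite tensMr_genE !dBB_tens mulrDr !tensMr_genE dB_genE parityK dB_parity.
rewrite !mulrBl !mul1r tensMr_genX tensNl !linearB /=.
by rewrite opprD addrCA.
Qed.
End TensorDifferential.

(** * The homotopy between Delta and tau Delta *)

Section Homotopy.
Context (k : comPzRingType) (X : rackType).
Local Notation B := (Balg k X).
Local Notation BB := (BB k X).
Implicit Types (x y : X) (a b : B) (s t : BB).

Fact tau_is_linear : linear (@tau k X).
Proof. exact: lext_is_linear. Qed.
HB.instance Definition _ := GRing.isLinear.Build k BB BB _ (@tau k X) tau_is_linear.

Fact Delta_is_scalable : scalable (@Delta k X).
Proof. by move=> c b; rewrite /Delta pres_mapZ scalar_mapBBM. Qed.
HB.instance Definition _ := GRing.isScalable.Build k B BB _ (@Delta k X) Delta_is_scalable.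

Lemma tau_bas (p : Bmon X * Bmon X) :
  tau (bas k p) = (-1) ^+ (degm p.1 * degm p.2) *: bas k (p.2, p.1) :> BB.
Proof. exact: lextE. Qed.

(** The signed flip is an algebra morphism; both sides carry the sign of the
same permutation of four homogeneous factors, compared here by parity. *)
Lemma tauM s t : tau (s * t) = tau s * tau t.
Proof.
elim/freemod_ind: s => [|c p s IHs]; first by rewrite mul0r linear0 mul0r.
rewrite mulrDl -BBZl !linearP /= IHs mulrDl -BBZl; congr (_ *: _ + _) => {s IHs}.
elim/freemod_ind: t => [|c' q t IHt]; first by rewrite mulr0 linear0 mulr0.
rewrite mulrDr -BBZr !linearP /= IHt mulrDr -BBZr; congr (_ *: _ + _) => {t IHt}.
rewrite BBM /koszul linearZ /= !tau_bas -BBZl -BBZr BBM /koszul /= !scalerA.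
congr (_ *: _); rewrite -!exprD -signr_odd -[RHS]signr_odd; congr (_ ^+ _).
rewrite !degmM !(oddD, oddM).
by case: (odd (degm p.1)) (odd (degm p.2)) (odd (degm q.1)) (odd (degm q.2))
  => [] [] [] [].
Qed.

Lemma tau_tens_bas (m n : Bmon X) : tau ((bas k m : B) ⊗ (bas k n : B)) =
  (-1) ^+ (degm m * degm n) *: ((bas k n : B) ⊗ (bas k m : B)).
Proof. by rewrite !tens_bas tau_bas. Qed.

Lemma tensX x : genX k x ⊗ genX k x = (genX k x ⊗ 1) * (1 ⊗ genX k x).
Proof. by rewrite tensMl_genX mulr1. Qed.

Lemma tensE x : genE k x ⊗ genE k x = (genE k x ⊗ 1) * (1 ⊗ genE k x).
Proof. by rewrite tensMl_genE mulr1. Qed.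

Lemma tau_DeltaX x : tau (Delta (genX k x)) = genX k x ⊗ genX k x.
Proof. by rewrite DeltaX tau_tens_bas degX scale1r. Qed.

Lemma tau_DeltaE x :
  tau (Delta (genE k x)) = genX k x ⊗ genE k x + genE k x ⊗ 1.
Proof.
by rewrite DeltaE linearD /= monoid_alg1 !tau_tens_bas degX degm1 muln0 !scale1r.
Qed.

Lemma left_leibniz_X x : left_leibniz 1 (genX k x ⊗ genX k x) 0.
Proof.
move=> t; rewrite tensX (left_leibnizM (left_leibniz_Xl x) (left_leibniz_Xr x)).
by rewrite mul0r mulr0 scaler0 addr0 mulr1.
Qed.

(** The source of the homotopy: D(e_x ⊗ e_x) = (x - 1) ⊗ e_x - e_x ⊗ (x - 1),
which regroups as (tau Delta)(e_x) - Delta(e_x). *)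
Lemma left_leibniz_E x : left_leibniz 1 (genE k x ⊗ genE k x)
  (tau (Delta (genE k x)) - Delta (genE k x)).
Proof.
move=> t; rewrite tensE (left_leibnizM (left_leibniz_El x) (left_leibniz_Er x)) mulN1r opprK.
congr (_ * _ + _); rewrite tau_DeltaE DeltaE scaleN1r mulrBl mulrBr mul1r mulr1.
rewrite tensMl_genX tensMl_genE !mulr1 !opprD opprK.
by rewrite -!addrA; congr (_ + _); rewrite addrC [RHS]addrC addrAC -addrA.
Qed.

Lemma left_leibniz_tauDelta x :
  left_leibniz (-1) (tau (Delta (genE k x))) (genX k x ⊗ genX k x - 1).
Proof.
move=> t; rewrite tau_DeltaE.
have -> : genX k x ⊗ genE k x = (genX k x ⊗ 1) * (1 ⊗ genE k x).
  by rewrite tensMl_genX mulr1.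
have l := left_leibnizM (left_leibniz_Xl x : @left_leibniz k _ _ _ _)
  (left_leibniz_Er x : @left_leibniz k _ _ _ _).
rewrite mul1r in l; rewrite (left_leibnizD l (left_leibniz_El x)).
congr (_ * _ + _); rewrite mul0r add0r scale1r mulrBr mulr1 tensX.
by rewrite addrA subrK.
Qed.

Lemma left_leibniz_Delta x :
  left_leibniz (-1) (Delta (genE k x)) (genX k x ⊗ genX k x - 1).
Proof.
move=> t; rewrite DeltaE.
have -> : genE k x ⊗ genX k x = (genE k x ⊗ 1) * (1 ⊗ genX k x).
  by rewrite tensMl_genE mulr1.
have l := left_leibnizM (left_leibniz_El x : @left_leibniz k _ _ _ _)
  (left_leibniz_Xr x : @left_leibniz k _ _ _ _).
rewrite mulr1 in l; rewrite (left_leibnizD l (left_leibniz_Er x)).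
congr (_ * _ + _); rewrite mulr0 scaler0 addr0 mulrBl mul1r tensX.
by rewrite addrA subrK.
Qed.

Lemma dBB1 : dBB (1 : BB) = 0.
Proof. by rewrite -tens11 dBB_tens dB1 linear0 tens0l addr0. Qed.

(** Both sides are derivations along Delta, and they take the value
x ⊗ x - 1 at e_x. *)
Lemma dBB_Delta b : dBB (Delta b) = Delta (dB b).
Proof.
pose u : {linear B -> BB} := dBB (X := X) \o Delta.
pose v : {linear B -> BB} := Delta \o dB (X := X).
apply: (@Balg_gen_ext k X _ u v) => [|x {}b /= IHb|x {}b /= IHb].
- by rewrite /= dB1 rmorph0 rmorph1 dBB1.
- rewrite dB_genX !rmorphM /= DeltaX left_leibniz_X IHb.
  by rewrite mul0r add0r scale1r.
rewrite dB_genE rmorphM /= left_leibniz_Delta IHb rmorphB !rmorphM rmorphB /=.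
by rewrite rmorph1 DeltaX scaleN1r.
Qed.

(** The map h, convertible to the A-linear one, presented as a derivation
twisted by tau Delta on the left and Delta on the right. *)
Definition hB (b : B) : BB := tder (@diag k X) (@h_formula k X) b.

Fact hB_is_linear : linear hB.
Proof. by move=> c b b'; rewrite /hB tderZ /= diag_scalar scalar_mapBBM. Qed.
HB.instance Definition _ := GRing.isLinear.Build k B BB _ hB hB_is_linear.

Lemma hB1 : hB 1 = 0.
Proof.
have -> : 1 = ebas [::] :> B by rewrite /ebas big_nil.
by rewrite [LHS]h_ebas /h_formula big_ord0.
Qed.

Lemma hB_genX x b : hB (genX k x * b) = (genX k x ⊗ genX k x) * hB b.
Proof. by rewrite /hB tder_genX /= diag_genA. Qed.

Lemma hB_genE x b : hB (genE k x * b) =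
  (genE k x ⊗ genE k x) * Delta b - tau (Delta (genE k x)) * hB b.
Proof.
have diagJ (z : X) : diag (genA k z) = tau (Delta (genX k z)).
  by rewrite diag_genA tau_DeltaX.
apply: (tder_genE (rho := @Delta k X) (alpha := fun x => genE k x ⊗ genE k x)
                  (beta := fun x => tau (Delta (genE k x)))).
- exact: Delta_iota.
- exact: diag_scalarC.
- move=> y z /=; rewrite diag_genA.
  rewrite [in LHS]tensX -mulrA tensMr_genX tensMl_genX genE_rel.
  by rewrite tensE -mulrA tensMr_genE tensMl_genE parity_genX.
- by move=> y z /=; rewrite diagJ -!tauM -!rmorphM /= genE_rel.
move=> ys; rewrite /h_formula /tder_formula; apply: eq_bigr => i _.
rewrite -[in LHS]signr_odd -[in RHS]signr_odd; case: (odd i).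
  by rewrite !expr1 scaleN1r mulN1r.
by rewrite !expr0 scale1r mul1r.
Qed.

(** Both sides are even derivations twisted by tau Delta and Delta, and they
agree on generators; in the recursion the contributions of h(x b) and of
Delta(d b) cancel. *)
Lemma dBB_hB b : dBB (hB b) + hB (dB b) = tau (Delta b) - Delta b.
Proof.
pose u : {linear B -> BB} := (dBB (X := X) \o hB) \+ (hB \o dB (X := X)).
pose v : {linear B -> BB} := (tau \o Delta) \- Delta.
apply: (@Balg_gen_ext k X _ u v) => [|x {}b|x {}b] /=.
- by rewrite hB1 dB1 !linear0 rmorph1 -tens11 tau_tens_bas degm1 scale1r subrr addr0.
- rewrite hB_genX dB_genX hB_genX left_leibniz_X mul0r add0r scale1r -mulrDr => ->.
  by rewrite rmorphM tauM /= tau_DeltaX DeltaX mulrBr.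
rewrite hB_genE dB_genE mulrBl mul1r !linearB /= hB_genX hB_genE => IHb.
rewrite left_leibniz_E scale1r left_leibniz_tauDelta scaleN1r dBB_Delta.
rewrite rmorphM tauM /= !mulrBl mul1r.
have {IHb} -> : dBB (hB b) = tau (Delta b) - Delta b - hB (dB b) by rewrite -IHb addrK.
have cancel (p q r c w y : BB) :
    p - q + r - (c - (w - p - y)) + (c - (r - y)) = w - q.
  rewrite !opprB !addrA !subrK addrAC (addrAC _ w) addrK addrAC.
  by rewrite (addrAC p) subrr add0r addrC.
by rewrite !(mulrBr (tau _)) cancel.
Qed.
End Homotopy.

(** * Cochains as functions on B *)

Section Cochains.
Context (k : comPzRingType) (X : rackType).
Local Notation B := (Balg k X).
Local Notation BB := (BB k X).
Implicit Types (x y : X) (a b : B) (s t : BB).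

Lemma cochainB_iota n (f : cochain k X n) (a : Aalg k X) b :
  cochainB f (iota a * b) = augm a * cochainB f b.
Proof. exact: (linearZ_LR (homA f) a b). Qed.

Fact cochainB_is_scalar n (f : cochain k X n) : scalar (cochainB f).
Proof.
move=> c a b; rewrite -scalar_mapM -iota_scalar.
rewrite [LHS](linearP (homA f) (scalar_map (Amon X) c) a b); congr (_ + _).
rewrite -[LHS]/(augm (scalar_map (Amon X) c) * cochainB f a).
by rewrite /augm pres_mapZ rmorph1 mulr1.
Qed.
HB.instance Definition _ n (f : cochain k X n) :=
  GRing.isLinear.Build k B k _ (cochainB f) (cochainB_is_scalar f).

Lemma cochainB_ext n (f g : cochain k X n) : cochainB f =1 cochainB g -> f = g.
Proof. exact: homA_inj. Qed.

Lemma cochainBP n c (f g : cochain k X n) b :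
  cochainB (c *: f + g) b = c * cochainB f b + cochainB g b.
Proof. exact: homAP. Qed.

Lemma cochainB0 n b : cochainB (0 : cochain k X n) b = 0.
Proof.
by have := cochainBP (-1) (0 : cochain k X n) 0 b; rewrite scaler0 addr0 mulN1r addNr.
Qed.

Lemma cochainBZ n c (f : cochain k X n) b : cochainB (c *: f) b = c * cochainB f b.
Proof. by rewrite -[c *: f]addr0 cochainBP cochainB0 addr0. Qed.

Lemma cochainBB n (f g : cochain k X n) b :
  cochainB (f - g) b = cochainB f b - cochainB g b.
Proof. by rewrite addrC -scaleN1r cochainBP mulN1r addrC. Qed.

Definition ihomB m n (f : cochain k X m) (g : cochain k X n) (t : BB) : k :=
  ihom f g t.
Fact ihomB_is_scalar m n (f : cochain k X m) (g : cochain k X n) :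
  scalar (ihomB f g).
Proof. exact: (@lext_is_linear _ _ k^o). Qed.
HB.instance Definition _ m n (f : cochain k X m) (g : cochain k X n) :=
  GRing.isLinear.Build k BB k _ (ihomB f g) (ihomB_is_scalar f g).

Lemma cochainB_bas0 n (f : cochain k X n) (p : Bmon X) :
  degm p != n -> cochainB f (bas k p) = 0.
Proof. exact: homA_bas0. Qed.

(** The sign (-1)^{|g||a|} may be replaced by the constant (-1)^{|g||f|}, since
f vanishes on monomials a of any other degree. This makes the formula valid
for all a and b. *)
Lemma ihomB_tens m n (f : cochain k X m) (g : cochain k X n) a b :
  ihomB f g (a ⊗ b) = (-1) ^+ (m * n) * (cochainB f a * cochainB g b).
Proof.
elim/freemod_ind: a => [|c p a IHa].
  by rewrite tens0l !linear0 mul0r mulr0.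
rewrite tensPl !linearP /= {}IHa mulrDl mulrDr -mulrA (mulrCA _ c).
congr (_ * _ + _); elim/freemod_ind: b => [|c' q b IHb].
  by rewrite !linear0 !mulr0.
rewrite !linearP /= {}IHb !mulrDr (mulrCA (cochainB f _)) (mulrCA ((-1) ^+ _) c').
congr (_ * _ + _); rewrite tens_bas.
rewrite [LHS](@lextE _ _ k^o) -[LHS]/((-1) ^+ (n * degm p) *
  (cochainB f (bas k p) * cochainB g (bas k q))).
have [pm|/cochainB_bas0 p0] := eqVneq (degm p) m.
  by rewrite pm mulnC.
by rewrite !p0 !mul0r !mulr0.
Qed.

Lemma cochainB_cup m n (f : cochain k X m) (g : cochain k X n) b :
  cochainB (cup f g) b = ihomB f g (Delta b).
Proof. exact: homA_cup. Qed.

Lemma cochainB_htpy m n (f : cochain k X m) (g : cochain k X n) b :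
  cochainB (htpy f g) b = - ihomB f g (hB b).
Proof. exact: homA_htpy. Qed.

(** Covers both kinds of faces: F is the identity, or the action of x_i. *)
Lemma mktuple_omit n (F : X -> X) (i : 'I_n.+1) (t : n.+1.-tuple X) :
  [tuple if (j < i)%N then F (tnth t (lift i j)) else tnth t (lift i j)
     | j < n] = map F (take i t) ++ drop i.+1 t :> seq X.
Proof.
have i_le : (i <= size t)%N by rewrite size_tuple ltnW.
have x0 := tnth t i; apply: (@eq_from_nth _ x0).
  rewrite size_cat size_map size_takel // size_drop !size_tuple.
  by have := ltn_ord i; lia.
move=> j; rewrite size_tuple => j_lt; pose j' := Ordinal j_lt.
rewrite -[j]/(val j') -tnth_nth tnth_mktuple /= (tnth_nth x0) /= nth_cat.
rewrite size_map size_takel // /bump; case: ltnP => [ji|ij].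
  by rewrite (nth_map x0) ?size_takel // add0n nth_take.
by rewrite nth_drop; congr nth; lia.
Qed.

Lemma face0E n (i : 'I_n.+1) (t : n.+1.-tuple X) :
  face0 i t = take i t ++ drop i.+1 t :> seq X.
Proof.
rewrite -[take i t]map_id -mktuple_omit; congr (tval _).
by apply: eq_mktuple => j; rewrite if_same.
Qed.

Lemma face1E n (i : 'I_n.+1) (t : n.+1.-tuple X) :
  face1 i t = [seq y ◁ tnth t i | y <- take i t] ++ drop i.+1 t :> seq X.
Proof. by rewrite -mktuple_omit. Qed.

Lemma ebas_genX xs x :
  ebas xs * genX k x = genX k x * ebas [seq y ◁ x | y <- xs].
Proof.
elim: xs => [|y xs IHxs]; first by rewrite /ebas !big_nil mulr1 mul1r.
rewrite /ebas /= !big_cons -!/(ebas _) -mulrA IHxs !mulrA.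
by rewrite genE_rel.
Qed.

Lemma ebas_cat xs ys : ebas (xs ++ ys) = ebas xs * ebas ys :> B.
Proof. by rewrite /ebas big_cat. Qed.

Lemma cochainB_genX n (f : cochain k X n) x b :
  cochainB f (genX k x * b) = cochainB f b.
Proof.
by rewrite -iota_genA cochainB_iota /augm pres_mapE mul1r.
Qed.

(** One Leibniz term of d gives the two faces of index i: the generator x moves
to the left through xs, acting on it, and is then absorbed by A-linearity. *)
Lemma cochainB_dterm n (f : cochain k X n) xs x ys :
  cochainB f (ebas xs * (genX k x - 1) * ebas ys) =
  cochainB f (ebas ([seq y ◁ x | y <- xs] ++ ys)) - cochainB f (ebas (xs ++ ys)).
Proof.
rewrite mulrBr mulr1 mulrBl linearB /= ebas_genX -mulrA cochainB_genX.
by rewrite !ebas_cat.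
Qed.

Lemma cochainB_tuple n (f : cochain k X n) (t : n.-tuple X) :
  cochainB f (ebas t) = f (bas k t).
Proof. exact: homA_ebas. Qed.

Lemma dB_ebas (xs : seq X) : dB (ebas xs : B) = \sum_(i < size xs) (-1) ^+ i *:
  (ebas (take i xs) * (genX k (tnth (in_tuple xs) i) - 1) *
   ebas (drop i.+1 xs)).
Proof.
rewrite [LHS](aextE (V := restr (@iota k X) B^o)); apply: eq_bigr => i _.
rewrite -[in LHS]signr_odd -[in RHS]signr_odd; case: (odd i).
  by rewrite !expr1 scaleN1r mulN1r.
by rewrite !expr0 scale1r mul1r.
Qed.

(** As d is A-linear, cochains composed with d can be compared on the basis of B
over A. *)
Definition dA : Bmod k X -> Bmod k X := @dB k X.
Fact dA_is_linear : linear dA.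
Proof. by move=> a b b'; exact: tderP. Qed.
HB.instance Definition _ :=
  GRing.isLinear.Build (Aalg k X) (Bmod k X) (Bmod k X) _ dA dA_is_linear.

(** The rack differential is d modulo the augmentation of A. In degrees other
than n + 1 both sides vanish on the basis, as d lowers the degree by one. *)
Lemma cochainB_cobd n (f : cochain k X n) b :
  cochainB (cobd f) b = cochainB f (dB b).
Proof.
pose u : {linear Bmod k X -> kmod k X} := homA (cobd f).
pose v : {linear Bmod k X -> kmod k X} := homA f \o dA.
apply: (@Bmod_ext k X _ u v) => xs.
rewrite -[LHS]/(cochainB (cobd f) (ebas xs)) -[RHS]/(cochainB f (dB (ebas xs))).
rewrite dB_ebas linear_sum /=.
under eq_bigr => i _ do rewrite linearZ /= cochainB_dterm.
have [xsn|nxs] := eqVneq (size xs) n.+1; last first.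
  rewrite [LHS]homA_ebas0 // big1 // => i _.
  have ys0 (ys : seq X) : size ys = i ->
      cochainB f (ebas (ys ++ drop i.+1 xs)) = 0.
    move=> ysi; apply: homA_ebas0; rewrite size_cat ysi size_drop.
    by apply: contraNneq nxs; have := ltn_ord i; lia.
  have i_le := ltnW (ltn_ord i).
  by rewrite !ys0 ?size_map ?size_takel // subrr mulr0.
have [t xst] : exists t : n.+1.-tuple X, xs = t by exists (Tuple (introT eqP xsn)).
subst xs.
rewrite cochainB_tuple -[LHS]/(f (bd (bas k t))) /bd lextE linearB /= !linear_sum /=.
rewrite -sumrB (reindex (cast_ord (esym xsn))) /=; last first.
  exact/onW_bij/(Bijective (cast_ordK _) (cast_ordKV _)).
apply: eq_bigr => i _; rewrite (tnth_nth (tnth t i)) /= -tnth_nth.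
rewrite -face0E -face1E !cochainB_tuple !linearZ /= exprS mulN1r.
by rewrite !mulNr opprK addrC mulrBr.
Qed.

Lemma ihomB_dBB m n (f : cochain k X m) (g : cochain k X n) t :
  ihomB f g (dBB t) = (-1) ^+ n * ihomB (cobd f) g t + ihomB f (cobd g) t.
Proof.
elim/freemod_ind: t => [|c [p q] t IHt]; first by rewrite !linear0 mulr0 addr0.
rewrite !linearP /= {}IHt mulrDr (mulrCA _ c) addrACA -mulrDr.
congr (_ * _ + _); rewrite -tens_bas dBB_tens linearD /= !ihomB_tens !cochainB_cobd.
(* The sign of the first summand is (-1)^n (-1)^((m + 1) n) = (-1)^(m n). *)
rewrite [in RHS]mulrA -exprD mulSn addnA addnn -[X in _ = X * _ + _]signr_odd oddD odd_double /=.
rewrite signr_odd; congr (_ + _); rewrite parity_bas linearZ /= mulnS exprD.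
have [->|/cochainB_bas0 p0] := eqVneq (degm p) m; last first.
  by rewrite p0 mulr0 !mul0r !mulr0.
by rewrite -!mulrA mulrCA.
Qed.

Lemma ihomB_tau m n (f : cochain k X m) (g : cochain k X n) t :
  ihomB f g (tau t) = (-1) ^+ (m * n) * ihomB g f t.
Proof.
elim/freemod_ind: t => [|c [p q] t IHt]; first by rewrite !linear0 mulr0.
rewrite !linearP /= {}IHt mulrDr (mulrCA _ c); congr (_ * _ + _).
rewrite -tens_bas tau_tens_bas linearZ /= !ihomB_tens.
have [->|/cochainB_bas0 p0] := eqVneq (degm p) n; last first.
  by rewrite !p0 !(mul0r, mulr0).
have [->|/cochainB_bas0 q0] := eqVneq (degm q) m; last first.
  by rewrite !q0 !(mul0r, mulr0).
by rewrite (mulnC n) (mulrC (cochainB g _)).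
Qed.

Lemma htpyZl m n c (f : cochain k X m) (g : cochain k X n) :
  htpy (c *: f) g = c *: htpy f g.
Proof.
have htpy0 : htpy 0 g = 0 :> cochain k X (m + n).-1.
  by have := htpyPl (-1) 0 (0 : cochain k X m) g; rewrite scaler0 addr0 scaleN1r addNr.
by rewrite -[c *: f]addr0 htpyPl htpy0 addr0.
Qed.

(** * The homotopy formula and graded commutativity *)

Lemma cup_homotopy m n (f : cochain k X m) (g : cochain k X n) b :
  cochainB (cup f g) b - (-1) ^+ (m * n) * cochainB (cup g f) b =
  cochainB (cobd (htpy f g)) b
  + (cochainB (htpy ((-1) ^+ n *: cobd f) g) b + cochainB (htpy f (cobd g)) b).
Proof.
rewrite htpyZl cochainBZ cochainB_cobd !cochainB_htpy !cochainB_cup.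
rewrite -ihomB_tau mulrN -opprD -ihomB_dBB -opprD -linearD /= (addrC (hB _)) dBB_hB.
by rewrite linearB /= opprB.
Qed.

Lemma cobd_cup m n (f : cochain k X m) (g : cochain k X n) b :
  cochainB (cobd (cup f g)) b =
  (-1) ^+ n * cochainB (cup (cobd f) g) b + cochainB (cup f (cobd g)) b.
Proof. by rewrite cochainB_cobd !cochainB_cup -dBB_Delta ihomB_dBB. Qed.

Lemma cupBl m n (f f' : cochain k X m) (g : cochain k X n) :
  cup (f - f') g = cup f g - cup f' g.
Proof. by rewrite addrC -scaleN1r cupPl scaleN1r addrC. Qed.

Lemma cupBr m n (f : cochain k X m) (g g' : cochain k X n) :
  cup f (g - g') = cup f g - cup f g'.
Proof. by rewrite addrC -scaleN1r cupPr scaleN1r addrC. Qed.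

Lemma cup0l m n (g : cochain k X n) : cup (0 : cochain k X m) g = 0.
Proof. by rewrite -(subrr 0) cupBl subrr. Qed.
Lemma cup0r m n (f : cochain k X m) : cup f (0 : cochain k X n) = 0.
Proof. by rewrite -(subrr 0) cupBr subrr. Qed.
Lemma htpy0l m n (g : cochain k X n) : htpy (0 : cochain k X m) g = 0.
Proof. by rewrite -(scale0r 0) htpyZl scale0r. Qed.
Lemma htpy0r m n (f : cochain k X m) : htpy f (0 : cochain k X n) = 0.
Proof.
by have := htpyPr (-1) f (0 : cochain k X n) 0; rewrite scaler0 addr0 scaleN1r addNr.
Qed.

Lemma is_coboundary0 n : is_coboundary (0 : cochain k X n).
Proof. by case: n => [|n] //; exists 0; rewrite linear0. Qed.

(** The degrees of f and g are deliberately unrelated: if they do not match then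
f is zero. Degrees such as (m + n).-1.+1 or m + n.+1 then require no
transport. *)
Lemma is_coboundary_cobd n n' (f : cochain k X n) (g : cochain k X n') :
  cochainB f =1 cochainB (cobd g) -> is_coboundary f.
Proof.
have [nn'|nn'] := eqVneq n n'.+1 => fg.
  by subst n; exists g; apply: cochainB_ext.
have -> : f = 0.
  apply: dualP; elim/freemod_ind => [|c t a IHa]; first by rewrite !linear0.
  rewrite linearP /= IHa addr0 -cochainB_tuple fg.
  by rewrite [cochainB _ _]homA_ebas0 ?size_tuple // mulr0.
exact: is_coboundary0.
Qed.

Lemma cohomology_eqP n (f g : cocycle k X n) :
  \pi_(cohomology k X n) f = \pi_(cohomology k X n) g <->
  is_coboundary (f - g : cochain k X n).
Proof.
split=> [/eqP|fg].
  by rewrite -Quotient.idealrBE => /asboolP.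
by apply/eqP; rewrite -Quotient.idealrBE; apply/asboolP.
Qed.

Lemma cocycle_cobd n (f : cocycle k X n) : cobd f = 0.
Proof. by case: f => f fP; apply/eqP. Qed.

Lemma cup_is_cocycle m n (f : cocycle k X m) (g : cocycle k X n) :
  cup f g \in @cocycle_pred k X (m + n).
Proof.
apply/eqP/cochainB_ext => b.
by rewrite cobd_cup !cocycle_cobd cup0l cup0r !cochainB0 mulr0 addr0.
Qed.

Definition cup_cocycle m n (f : cocycle k X m) (g : cocycle k X n) : cocycle k X (m + n) :=
  Cocycle (cup_is_cocycle f g).

Lemma cup_coboundary_l m n (f : cochain k X m) (g : cocycle k X n) :
  is_coboundary f -> is_coboundary (cup f g).
Proof.
case: m f => [|m] f; first by move=> /= ->; rewrite cup0l; apply: is_coboundary0.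
move=> [u ->]; apply: (@is_coboundary_cobd _ _ _ ((-1) ^+ n *: cup u g)) => b.
rewrite linearZ /= cochainBZ cobd_cup cocycle_cobd cup0r cochainB0 addr0.
by rewrite mulrA -expr2 sqrr_sign mul1r.
Qed.

Lemma cup_coboundary_r m n (f : cocycle k X m) (g : cochain k X n) :
  is_coboundary g -> is_coboundary (cup f g).
Proof.
case: n g => [|n] g; first by move=> /= ->; rewrite cup0r; apply: is_coboundary0.
move=> [u ->]; apply: (@is_coboundary_cobd _ _ _ (cup f u)) => b.
by rewrite cobd_cup cocycle_cobd cup0l cochainB0 mulr0 add0r.
Qed.

Definition cupH m n (a : cohomology k X m) (b : cohomology k X n) :
    cohomology k X (m + n) :=
  \pi_(cohomology k X (m + n)) (cup_cocycle (repr a) (repr b)).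

Lemma cupH_pi m n (f : cocycle k X m) (g : cocycle k X n) :
  cupH (\pi_(cohomology k X m) f) (\pi_(cohomology k X n) g) =
  \pi_(cohomology k X (m + n)) (cup_cocycle f g).
Proof.
rewrite /cupH; set f' := repr _; set g' := repr _.
have fB : is_coboundary (f' - f : cochain k X m).
  by apply/cohomology_eqP; rewrite reprK.
have gB : is_coboundary (g' - g : cochain k X n).
  by apply/cohomology_eqP; rewrite reprK.
transitivity (\pi_(cohomology k X (m + n)) (cup_cocycle f g')); apply/cohomology_eqP.
  by rewrite /= -cupBl; apply: cup_coboundary_l.
by rewrite /= -cupBr; apply: cup_coboundary_r.
Qed.

Lemma cohomology_piZ n c (f : cocycle k X n) :
  \pi_(cohomology k X n) (c *: f) = c *: \pi_(cohomology k X n) f.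
Proof. exact/esym/cohomology_scaleE. Qed.

Definition cocycle_cast n n' (e : n = n') (f : cocycle k X n) : cocycle k X n' :=
  ecast i (cocycle k X i) e f.

Lemma pi_cocycle_cast n n' (e : n = n') (f : cocycle k X n) :
  ecast i (cohomology k X i) e (\pi_(cohomology k X n) f) =
  \pi_(cohomology k X n') (cocycle_cast e f).
Proof. by case: n' / e. Qed.

Lemma cochainB_cocycle_cast n n' (e : n = n') (f : cocycle k X n) b :
  cochainB (cocycle_cast e f : cochain k X n') b = cochainB (f : cochain k X n) b.
Proof. by case: n' / e. Qed.

Lemma cupHC m n (a : cohomology k X m) (b : cohomology k X n) :
  cupH a b =
  (-1) ^+ (m * n) *: ecast i (cohomology k X i) (addnC n m) (cupH b a).
Proof.
have [[f ->] [g ->]] := conj (cohomology_surj a) (cohomology_surj b).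
rewrite !cupH_pi pi_cocycle_cast -cohomology_piZ; apply/cohomology_eqP.
apply: (@is_coboundary_cobd _ _ _ (htpy f g)) => c.
rewrite cochainBB [cochainB (_ *: _) _]cochainBZ cochainB_cocycle_cast cup_homotopy.
by rewrite !cocycle_cobd scaler0 htpy0l htpy0r !cochainB0 !addr0.
Qed.

End Cochains.

Theorem theorem11 (k : comPzRingType) (X : rackType) :
  (forall (m n : nat) (f : cochain k X m) (g : cochain k X n) (b : Balg k X),
     cochainB (cup f g) b - (-1) ^+ (m * n) * cochainB (cup g f) b =
     cochainB (cobd (htpy f g)) b
     + (cochainB (htpy ((-1) ^+ n *: cobd f) g) b + cochainB (htpy f (cobd g)) b))
  /\
  (exists cupH : forall m n,
       cohomology k X m -> cohomology k X n -> cohomology k X (m + n),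
     (forall m n (f : cocycle k X m) (g : cocycle k X n),
        exists2 fg : cocycle k X (m + n), fg = cup f g :> cochain k X (m + n) &
          cupH m n (\pi_(cohomology k X m) f) (\pi_(cohomology k X n) g)
          = \pi_(cohomology k X (m + n)) fg)
     /\
     (forall m n (a : cohomology k X m) (b : cohomology k X n),
        cupH m n a b =
        (-1) ^+ (m * n) *:
          ecast i (cohomology k X i) (addnC n m) (cupH n m b a))).
Proof.
split=> [m n f g b|]; first exact: cup_homotopy.
exists (@cupH k X); split=> [m n f g|m n a b]; last exact: cupHC.
by exists (cup_cocycle f g); rewrite ?cupH_pi.
Qed.
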